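(* Let $m=\alpha n$, $k=\beta_w^+ n$ with $\alpha,\beta_w^+$ fixed constants such that $(\alpha,\beta_w^+)$ is below the ''signed'' fundamental $\ell_1$ characterization, i.e. $\alpha>\alpha_w^+$ with $\alpha_w^+=\alpha_w^+(\beta_w^+)$ as defined in the context. Let $\sigma>0$, let $r_{socp+}>0$ (depending on $n$) and let $r_{socp+}^{(sc)}=\lim_{n\to\infty}\frac{r_{socp+}}{\sqrt n}$. Assume the signed SOCP is feasible with overwhelming probability and $E\xi_{prim+}$ is finite, as described in the context. Let $\mathbf g,\mathbf h$ be $m\times1$ and $n\times1$ vectors of i.i.d. standard normals, and let $\xi_{prim+}^{(gen)}(\sigma,\mathbf g,\mathbf h,r_{socp+})$, $\nu_{gen+}$ and $\|\mathbf w_{gen+}\|_2$ be as defined in the context. Set $$C^+(\theta^+)=(1-\beta_w^+)\sqrt{\tfrac1{2\pi}}\,e^{-(\mathrm{erfinv}(2\frac{1-\theta^+}{1-\beta_w^+}-1))^2},$$ $$D^+(\theta^+)=\frac{1-\beta_w^+}{\sqrt{2\pi}}\left(\frac{\sqrt2\,\mathrm{erfinv}(2\frac{1-\theta^+}{1-\beta_w^+}-1)}{e^{(\mathrm{erfinv}(2\frac{1-\theta^+}{1-\beta_w^+}-1))^2}}\right)+\theta^+,$$ $$A^+(\theta^+)=\sigma\frac{\alpha-D^+(\theta^+)}{r_{socp+}^{(sc)}},\qquad B^+(\theta^+)=\sigma\frac{C^+(\theta^+)}{r_{socp+}^{(sc)}},\qquad F^+(\theta^+)=\sqrt2\,\mathrm{erfinv}\Big(2\frac{1-\theta^+}{1-\beta_w^+}-1\Big).$$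 Let $\hat\theta^+$ be the solution (in $\theta^+$) of $$F^+(\theta^+)\,\frac{-(A^+B^+-C^+)-\sqrt{(A^+B^+-C^+)^2-((B^+)^2+\theta^+)((A^+)^2-\alpha+D^+)}}{(A^+)^2-\alpha+D^+}=1,$$ where $A^+,B^+,C^+,D^+$ are evaluated at $\theta^+$. Then the concentrating points (in the limit $n\to\infty$) of $\nu_{gen+}$, $\|\mathbf w_{gen+}\|_2$ and $\xi_{prim+}^{(gen)}$ are, with $A^+,B^+,C^+,D^+$ now evaluated at $\hat\theta^+$, $$E\nu_{gen+}=\frac{-(A^+B^+-C^+)-\sqrt{(A^+B^+-C^+)^2-((B^+)^2+\hat\theta^+)((A^+)^2-\alpha+D^+)}}{(A^+)^2-\alpha+D^+},$$ $$E\|\mathbf w_{gen+}\|_2=\sigma\sqrt{\frac{(E\nu_{gen+})^2D^+-2E\nu_{gen+}C^++\hat\theta^+}{\alpha(E\nu_{gen+})^2-\big((E\nu_{gen+})^2D^+-2E\nu_{gen+}C^++\hat\theta^+\big)}},$$ $$\lim_{n\to\infty}\frac{E\xi_{prim+}^{(gen)}(\sigma,\mathbf g,\mathbf h,r_{socp+})}{\sqrt n}=\sigma\sqrt{\alpha(E\nu_{gen+})^2-\big((E\nu_{gen+})^2D^+-2E\nu_{gen+}C^++\hat\theta^+\big)}-E\nu_{gen+}\,r_{socp+}^{(sc)}.$$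
   Context: $\mathbf z^{(1)}\in\mathbb R^n$ is the all-ones vector; $\mathrm{erfinv}$ is the inverse of $\mathrm{erf}(x)=\frac{2}{\sqrt\pi}\int_0^x e^{-t^2}dt$. Linear regime: $m=\alpha n<n$, $k=\beta_w^+ n$, constants independent of $n$; $\mathbf g,\mathbf h$ independent. The parameter $\theta^+$ ranges in $\beta_w^+\le\theta^+\le1$. $$\xi_{prim+}^{(gen)}(\sigma,\mathbf g,\mathbf h,r_{socp+})=\max_{\nu,\lambda^{(2)}}\ \sigma\sqrt{\|\mathbf g\|_2^2\nu^2-\|\nu\mathbf h+\mathbf z^{(1)}-\lambda^{(2)}\|_2^2}-\nu r_{socp+}$$ subject to $\nu\ge0$, $\lambda_i^{(2)}=0$ for $n-k+1\le i\le n$, $\lambda_i^{(2)}\ge0$ for $1\le i\le n-k$ (and the expression under the root nonnegative). $\nu_{gen+},\lambda^{(gen+)}$ denote its solution and $$\|\mathbf w_{gen+}\|_2=\sigma\frac{\|\nu_{gen+}\mathbf h+\mathbf z^{(1)}-\lambda^{(gen+)}\|_2}{\sqrt{\|\mathbf g\|_2^2\nu_{gen+}^2-\|\nu_{gen+}\mathbf h+\mathbf z^{(1)}-\lambda^{(gen+)}\|_2^2}}.$$ In the displayed conclusions $E\nu_{gen+}$ and $E\|\mathbf w_{gen+}\|_2$ denote the limiting ($n\to\infty$) values of the expectations, around which the random quantities concentrate. Signed SOCP: $\min_{\mathbf x}\|\mathbf x\|_1$ subject to $\|\mathbf y-A\mathbf x\|_2\le r_{socp+}$, $\mathbf x_i\ge0$,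 $1\le i\le n$, where $\mathbf y=A\tilde{\mathbf x}+\mathbf v$, $A$ is $m\times n$ with i.i.d. standard normal entries, $\mathbf v$ is $m\times1$ with i.i.d. $N(0,\sigma^2)$ entries, $\tilde{\mathbf x}_1=\dots=\tilde{\mathbf x}_{n-k}=0$ and $\tilde{\mathbf x}_{n-k+1},\dots,\tilde{\mathbf x}_n\ge0$. ''With overwhelming probability'' means with probability at least $1-e^{-cn}$ for a constant $c>0$ independent of $n$. Also $$\xi_{prim+}(\sigma,\mathbf g,\mathbf h,\tilde{\mathbf x},r_{socp+})=\max_{\nu\ge 0,\ \lambda_i^{(2)}\ge0,\,1\le i\le n}\ \sigma\sqrt{\|\mathbf g\|_2^2\nu^2-\|\nu\mathbf h+\mathbf z^{(1)}-\lambda^{(2)}\|_2^2}-\sum_{i=n-k+1}^n\lambda_i^{(2)}\tilde{\mathbf x}_i-\nu r_{socp+}.$$ The standing assumption is that $\tilde{\mathbf x},\alpha,\beta_w^+,\sigma,r_{socp+}$ are such that the signed SOCP is feasible with overwhelming probability and $E\xi_{prim+}$ is finite. Signed fundamental $\ell_1$ characterization: for given $\beta_w^+$, $\alpha_w^+$ is the solution of $$(1-\beta_w^+)\frac{\sqrt{\frac1{2\pi}}\,e^{-(\mathrm{erfinv}(2\frac{1-\alpha_w^+}{1-\beta_w^+}-1))^2}}{\alpha_w^+}-\sqrt2\,\mathrm{erfinv}\Big(2\frac{1-\alpha_w^+}{1-\beta_w^+}-1\Big)=0.$$ A pair $(\alpha,\beta_w^+)$ is below the characterization when $\alpha>\a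lpha_w^+$.
   Formalization: As the optimal values are infinite with positive probability for each n, ''Eξ_prim+ finite'' is taken off an exponentially unlikely event, and limits of expectations are limits of means truncated at any level above the limit, with exponential concentration; r^(sc)>0 is assumed. *)

(* Defs.v *)
From HB Require Import structures.
From mathcomp Require Import all_boot all_order all_algebra.
From mathcomp Require Import all_classical all_reals all_analysis.
Import Order.TTheory GRing.Theory Num.Theory.
Import numFieldNormedType.Exports.

Set Implicit Arguments.
Unset Strict Implicit.
Unset Printing Implicit Defensive.

Local Open Scope classical_set_scope.
Local Open Scope ring_scope.

Section ErrorFunction.
Variable R : realType.

(* The integral from 0 to x is oriented, whence the case distinction. *)
Definition erf (x : R) : R :=
  2 / Num.sqrt pi *
  (if 0 <= x then \int[lebesgue_measure]_(t in `[0, x]) expR (- t ^+ 2)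
   else - \int[lebesgue_measure]_(t in `[x, 0]) expR (- t ^+ 2)).

(* Inverse of erf on ]-1, 1[; the value outside that interval (in particular
   at -1 and 1, where the inverse is infinite) is the dummy 0. *)
Definition erfinv (y : R) : R := xget 0 [set x | erf x = y].

End ErrorFunction.

Section LimitFormulas.
Variable R : realType.
Implicit Types (alpha beta sigma rsc theta nu aw : R).

Definition erfinv_arg beta theta : R :=
  erfinv (2 * ((1 - theta) / (1 - beta)) - 1).

(* alpha_w is the solution of the equation in the range in which
   erfinv is evaluated inside ]-1, 1[. *)
Definition signed_l1_threshold beta aw : Prop :=
  beta < aw < 1 /\
  (1 - beta) * (Num.sqrt (1 / (2 * pi)) * expR (- erfinv_arg beta aw ^+ 2) / aw)
    - Num.sqrt 2 * erfinv_arg beta aw = 0.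

Definition Cp beta theta : R :=
  (1 - beta) * Num.sqrt (1 / (2 * pi)) * expR (- erfinv_arg beta theta ^+ 2).

Definition Dp beta theta : R :=
  (1 - beta) / Num.sqrt (2 * pi) *
  (Num.sqrt 2 * erfinv_arg beta theta / expR (erfinv_arg beta theta ^+ 2))
  + theta.

Definition Ap alpha beta sigma rsc theta : R :=
  sigma * ((alpha - Dp beta theta) / rsc).

Definition Bp beta sigma rsc theta : R := sigma * (Cp beta theta / rsc).

Definition Fp beta theta : R := Num.sqrt 2 * erfinv_arg beta theta.

Definition discr alpha beta sigma rsc theta : R :=
  let A := Ap alpha beta sigma rsc theta in
  let B := Bp beta sigma rsc theta in
  let C := Cp beta theta in
  let D := Dp beta theta in
  (A * B - C) ^+ 2 - (B ^+ 2 + theta) * (A ^+ 2 - alpha + D).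

Definition nu_lim alpha beta sigma rsc theta : R :=
  let A := Ap alpha beta sigma rsc theta in
  let B := Bp beta sigma rsc theta in
  let C := Cp beta theta in
  let D := Dp beta theta in
  (- (A * B - C) - Num.sqrt (discr alpha beta sigma rsc theta))
  / (A ^+ 2 - alpha + D).

(* Num.sqrt is 0 on negative numbers, so the reality of the square root is
   required explicitly. The remaining junk values (erfinv at -1 and 1, division
   by 0) all turn the left-hand side into 0, hence give no solution. *)
Definition is_theta_hat alpha beta sigma rsc theta : Prop :=
  [/\ beta <= theta <= 1,
      0 <= discr alpha beta sigma rsc theta &
      Fp beta theta * nu_lim alpha beta sigma rsc theta = 1].

Definition res_lim beta theta nu : R :=
  nu ^+ 2 * Dp beta theta - 2 * nu * Cp beta theta + theta.

Definition w_lim alpha beta sigma theta nu : R :=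
  sigma * Num.sqrt (res_lim beta theta nu
                    / (alpha * nu ^+ 2 - res_lim beta theta nu)).

Definition xi_lim alpha beta sigma rsc theta nu : R :=
  sigma * Num.sqrt (alpha * nu ^+ 2 - res_lim beta theta nu) - nu * rsc.

End LimitFormulas.

Section Programs.
Variable R : realType.

(* The library norm on matrices is the sup norm. *)
Definition l2norm n (x : 'cV[R]_n) : R := Num.sqrt (\sum_i x i 0 ^+ 2).

Section FixedDimensions.
Variables m n k : nat.

(* Coordinates are numbered from 0: the first n - k ones are i < n - k. *)
Definition sparse_signed (x : 'cV[R]_n) : Prop :=
  (forall i : 'I_n, (i < n - k)%N -> x i 0 = 0) /\
  (forall i : 'I_n, (n - k <= i)%N -> 0 <= x i 0).

Definition socp_feasible (r : R) (A : 'M[R]_(m, n)) (v : 'cV[R]_m)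
    (xt : 'cV[R]_n) : Prop :=
  exists x : 'cV[R]_n,
    (forall i, 0 <= x i 0) /\ l2norm (A *m xt + v - A *m x) <= r.

Section Duals.
Variables (sigma r : R) (g : 'cV[R]_m) (h : 'cV[R]_n).

Definition residual (nu : R) (lam : 'cV[R]_n) : 'cV[R]_n :=
  nu *: h + const_mx 1 - lam.

Definition radicand (nu : R) (lam : 'cV[R]_n) : R :=
  l2norm g ^+ 2 * nu ^+ 2 - l2norm (residual nu lam) ^+ 2.

Definition prim_feasible (p : R * 'cV[R]_n) : Prop :=
  [/\ 0 <= p.1, forall i, 0 <= p.2 i 0 & 0 <= radicand p.1 p.2].

Definition prim_obj (xt : 'cV[R]_n) (p : R * 'cV[R]_n) : R :=
  sigma * Num.sqrt (radicand p.1 p.2)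
  - \sum_(i < n | (n - k <= i)%N) p.2 i 0 * xt i 0 - p.1 * r.

Definition xi_prim (xt : 'cV[R]_n) : \bar R :=
  ereal_sup [set (prim_obj xt p)%:E | p in prim_feasible].

Definition gen_feasible (p : R * 'cV[R]_n) : Prop :=
  [/\ 0 <= p.1,
      forall i : 'I_n, (n - k <= i)%N -> p.2 i 0 = 0,
      forall i : 'I_n, (i < n - k)%N -> 0 <= p.2 i 0 &
      0 <= radicand p.1 p.2].

Definition gen_obj (p : R * 'cV[R]_n) : R :=
  sigma * Num.sqrt (radicand p.1 p.2) - p.1 * r.

Definition xi_gen : \bar R :=
  ereal_sup [set (gen_obj p)%:E | p in gen_feasible].

Definition is_gen_solution (p : R * 'cV[R]_n) : Prop :=
  gen_feasible p /\ (forall q, gen_feasible q -> gen_obj q <= gen_obj p).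

(* A maximizer if there is one, the dummy (0, 0) otherwise. *)
Definition gen_solution : R * 'cV[R]_n := xget (0, 0) is_gen_solution.

Definition nu_gen : R := gen_solution.1.

Definition w_gen : R :=
  let p := gen_solution in
  sigma * (l2norm (residual p.1 p.2) / Num.sqrt (radicand p.1 p.2)).

End Duals.
End FixedDimensions.
End Programs.

Section Probability.
Context (R : realType) (d : measure_display) (T : measurableType d)
  (P : probability T R).

Definition mutually_independent (I : finType) (X : I -> {RV P >-> R}) : Prop :=
  forall (J : {set I}) (B : I -> set R), (forall i, measurable (B i)) ->
    P (\bigcap_(i in [set i | i \in J]) (X i @^-1` B i)) =
    (\prod_(i in J) P (X i @^-1` B i))%E.

(* Independent centered normal variables with standard deviations s. *)
Definition indep_normal (I : finType) (s : I -> R) (X : I -> {RV P >-> R})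
    : Prop :=
  mutually_independent X /\
  (forall i (B : set R), measurable B ->
     P (X i @^-1` B) = normal_prob 0 (s i) B).

Definition sum_family (I J : Type) (U : Type) (f : I -> U) (g : J -> U)
    (s : I + J) : U :=
  match s with inl i => f i | inr j => g j end.

Definition random_vector n (X : 'I_n -> {RV P >-> R}) (w : T) : 'cV[R]_n :=
  \col_i X i w.

Definition random_matrix m n (X : 'I_m * 'I_n -> {RV P >-> R}) (w : T)
    : 'M[R]_(m, n) := \matrix_(a, b) X (a, b) w.

(* Probability at least 1 - e^(- c n) for a constant c > 0 and all large n,
   where n j is the dimension of the j-th problem. The set S j contains an
   event of that probability, so that its measurability is not presupposed. *)
Definition overwhelming (n : nat -> nat) (S : nat -> set T) : Prop :=
  exists2 c : R, 0 < c &
    \forall j \near \oo, exists E : set T,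
      [/\ measurable E, E `<=` S j &
          ((1 - expR (- c * (n j)%:R))%:E <= P E)%E].

(* Finiteness of the means of the X j, up to exceptional events of
   exponentially small probability. (The optimal value of the dual of a random
   cone program is +oo with positive probability in each fixed dimension.) *)
Definition overwhelmingly_finite_mean (n : nat -> nat) (X : nat -> T -> \bar R)
    : Prop :=
  exists2 c : R, 0 < c &
    \forall j \near \oo, exists E : set T,
      [/\ measurable E, ((1 - expR (- c * (n j)%:R))%:E <= P E)%E &
          P.-integrable E (X j)].

Definition truncated_mean (M : R) (X : T -> R) : \bar R :=
  'E_P[fun w => if `|X w| <= M then X w else 0].

(* l is the concentrating point of X j: the value around which X j concentrates
   and the limit of its means. The means are truncated at an arbitrary level
   above l, since nu_gen and xi_gen have no finite mean in any fixed dimension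
   (their tails at infinity are heavy, though exponentially unlikely). *)
Definition concentrating_point (n : nat -> nat) (X : nat -> T -> R) (l : R)
    : Prop :=
  (forall e : R, 0 < e -> overwhelming n (fun j => [set w | `|X j w - l| <= e]))
  /\ (forall M : R, `|l| < M ->
        truncated_mean M (X j) @[j --> \oo] --> l%:E).

End Probability.

(* Main.v *)
(* For fixed nu the optimal lambda is explicit, and with t = 1 / nu the program
   becomes the maximization of (sigma sqrt(|g|^2 - q_n(t)) - r) / t, where
   q_n(t) = sum_(i <= n-k) min(h_i + t, 0)^2 + sum_(i > n-k) (h_i + t)^2 is convex
   in t. A Chernoff bound makes |g|^2 / n and, for each fixed t, q_n(t) / n
   concentrate exponentially around alpha and a limit psi(t), which is strongly
   convex. Writing t = F^+, the equation defining theta-hat says that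
   alpha - psi(t) = (sigma / rsc)^2 (alpha - theta)^2, the squared stationarity
   condition of the limit program. The root chosen in nu_lim has the right sign,
   hence is the unique maximizer, unless nu_lim < 0; then the program is unbounded
   with overwhelming probability and E xi_prim is not finite. Since a concave
   function that is smaller at th - e and th + e than at th has its maximizers
   within e of th, concentration at three points suffices to locate nu_gen and
   then, by convexity of q_n, the two other quantities. *)

(* The maximizer is picked by [xget], so nothing says that [nu_gen] and [w_gen] are measurable in
   the sample. Concentration is therefore expressed through an event contained in the good set, and
   truncated means are estimated by monotonicity of the integral alone. Along the filter [ow],
   random limits obey the usual rules for sums, products and continuous maps. In [t = 1 / nu] the
   objective is [margin t / t] with [margin] concave, so a maximizer [th] is recognized by the line
   through the origin of slope [margin th / th], which supports the graph of [margin]. Strictness of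
   this at two neighbours of [th] survives small perturbations, and no uniform convergence in [t] is
   needed. The modulus of strong convexity of [psi] is [beta]: it comes from the coordinates whose
   multiplier is forced to be 0. The threshold enters because [alpha_w] is the minimum of [psi].
   This excludes the degenerate solution [theta = alpha], at which [alpha - psi t] vanishes and the
   squared stationarity condition carries no information. *)
Require Import Defs.
From HB Require Import structures.
From mathcomp Require Import all_boot all_order all_algebra.
From mathcomp Require Import all_classical all_reals all_analysis.
From mathcomp Require Import measurable_realfun.
From mathcomp Require Import ring lra.
Import Order.TTheory GRing.Theory Num.Theory.
Import numFieldNormedType.Exports HBNNSimple.
Local Open Scope classical_set_scope.
Local Open Scope ring_scope.

(** * Independence and exponential moments *)

(* Equality of the measures w.mu o X^-1 and c.nu on sets extends to integrals. *)
Lemma ge0_integral_weight d d' (T : measurableType d) (T' : measurableType d')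
    (R : realType) (mu : {measure set T -> \bar R})
    (nu : {measure set T' -> \bar R}) (X : T -> T') (w : T -> R) (c : R)
    (f : T' -> \bar R) :
  measurable_fun [set: T] X -> measurable_fun [set: T] w ->
  (forall x, 0 <= w x) ->
  (forall B, measurable B ->
    \int[mu]_(x in X @^-1` B) (w x)%:E = c%:E * nu B)%E ->
  measurable_fun [set: T'] f -> (forall y, 0 <= f y)%E ->
  (\int[mu]_x (f (X x) * (w x)%:E) = c%:E * \int[nu]_y f y)%E.
Proof.
move=> mX mw w0 XB mf f0.
pose f_ := nnsfun_approx measurableT mf.
have mf_ n : measurable_fun setT (fun x => ((f_ n (X x))%:E * (w x)%:E)%E).
  apply: emeasurable_funM; apply/measurable_EFinP => //.
  by apply: measurableT_comp.
have nd x m n : (m <= n)%N -> (f_ m x <= f_ n x)%R.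
  by move=> mn; exact/lefP/nd_nnsfun_approx.
transitivity (limn (fun n => \int[mu]_x ((f_ n (X x))%:E * (w x)%:E)))%E.
  rewrite -monotone_convergence//.
  - apply: eq_integral => x _; apply/esym/cvg_lim => //.
    by apply: cvgeZr => //; apply: cvg_nnsfun_approx.
  - by move=> n x _; rewrite mule_ge0 // lee_fin.
  - by move=> x _ m n mn; rewrite lee_wpmul2r // lee_fin ?w0 //; exact: nd.
have mfn n : measurable_fun setT (fun y => (f_ n y)%:E).
  exact/measurable_EFinP/measurable_funP.
transitivity (limn (fun n => c%:E * \int[nu]_y (f_ n y)%:E))%E; last first.
  rewrite limeMl //; last first.
    apply: ereal_nondecreasing_is_cvgn => m n mn.
    by apply: ge0_le_integral => // y _; rewrite lee_fin ?nd.
  rewrite -monotone_convergence//.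
    congr (_ * _)%E.
    apply: eq_integral => y _; apply/cvg_lim => //.
    by apply: cvg_nnsfun_approx.
  - by move=> n x _; rewrite lee_fin.
  - by move=> x _ m n mn; rewrite lee_fin; exact: nd.
congr (limn _); apply/funext => n.
have mB k : measurable (f_ n @^-1` [set k]).
  by rewrite -[X in measurable X]setTI; apply: measurable_funP.
have mXB k : measurable (X @^-1` (f_ n @^-1` [set k])).
  by rewrite -[X in measurable X]setTI; exact: mX.
have mi k : measurable_fun setT
    (fun x => k%:E * ((w x)%:E * (\1_(X @^-1` (f_ n @^-1` [set k])) x)%:E))%E.
  apply: emeasurable_funM; first exact: measurable_cst.
  by apply: emeasurable_funM; apply/measurable_EFinP.
rewrite integralT_nnsfun sintegralE.
transitivity (\sum_(k \in range (f_ n))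
    \int[mu]_x (k%:E * ((w x)%:E * (\1_(X @^-1` (f_ n @^-1` [set k])) x)%:E)))%E.
  rewrite -ge0_integral_fsum//.
    apply: eq_integral => x _.
    rewrite fimfunE -fsumEFin// ge0_mule_fsuml.
      apply: eq_fsbigr => k _; rewrite EFinM -muleA; congr (_ * _)%E.
      by rewrite muleC.
    by move=> r; rewrite EFinM nnfun_muleindic_ge0.
  move=> r x _.
  have [r0|r0] := leP 0 r; first by rewrite !mule_ge0 ?lee_fin.
  by rewrite (preimage_nnfun0 _ r0) preimage_set0 indic0 !mule0.
rewrite ge0_mule_fsumr; last by move=> r; exact: nnsfun_mulemu_ge0.
apply: eq_fsbigr => k _.
have [k0|k0] := leP 0 k; last first.
  rewrite !preimage_nnfun0// preimage_set0 measure0 !mule0.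
  by apply: integral0_eq => x _; rewrite indic0 !mule0.
rewrite ge0_integralZl_EFin//=.
- rewrite muleCA; congr (_ * _)%E.
  by rewrite -XB// [RHS]integral_mkcond epatch_indic.
- by move=> x _; rewrite mule_ge0 // lee_fin.
- by apply: emeasurable_funM; apply/measurable_EFinP.
Qed.

Lemma ge0_integral_normal_law d (T : measurableType d) (R : realType)
    (P : probability T R) (X : {RV P >-> R}) (f : R -> R) :
  (forall B : set R, measurable B -> P (X @^-1` B) = normal_prob 0 1 B) ->
  measurable_fun setT f -> (forall y, 0 <= f y) ->
  (\int[P]_w (f (X w))%:E = \int[normal_prob (0 : R) 1]_y (f y)%:E)%E.
Proof.
move=> XB mf f0; rewrite -[RHS]mul1e.
rewrite -(@ge0_integral_weight _ _ _ _ _ P (normal_prob (0 : R) 1) X (cst 1) 1 (EFin \o f)) //.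
- by apply: eq_integral => w _; rewrite mule1.
- exact: (measurable_funP X).
- move=> B mB; have mXB : measurable (X @^-1` B).
    by rewrite -[A in measurable A]setTI; exact: (measurable_funP X).
  rewrite -[LHS]/(\int[P]_(x in X @^-1` B) (cst 1%E x))%E.
  by rewrite integral_cst// !mul1e; exact: XB.
- exact/measurable_EFinP.
Qed.

(** * Products of independent factors and the Chernoff bound *)

Section Independence.
Context (R : realType) (d : measure_display) (T : measurableType d)
  (P : probability T R).

Lemma measurable_fun_prodr (I : finType) (Q : pred I) (h : I -> T -> R) :
  (forall i, measurable_fun setT (h i)) ->
  measurable_fun setT (fun x => \prod_(i | Q i) h i x).
Proof.
move=> mh; under eq_fun do rewrite -big_filter.
by apply: measurable_prod.
Qed.

Lemma integral_indicT (A : set T) : measurable A ->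
  (\int[P]_x (\1_A x)%:E = P A)%E.
Proof. by move=> mA; rewrite integral_indic// setIT. Qed.

Lemma expectation_prod_indep (I : finType) (X : I -> {RV P >-> R})
    (f : I -> R -> R) :
  mutually_independent X ->
  (forall i, measurable_fun setT (f i)) -> (forall i x, 0 <= f i x) ->
  (forall i, \int[P]_w (f i (X i w))%:E \is a fin_num)%E ->
  (\int[P]_w (\prod_i f i (X i w))%:E =
   (\prod_i fine (\int[P]_w (f i (X i w))%:E))%:E)%E.
Proof.
move=> indep mf f0 ffin.
(* Indicator functions are replaced by the f i one index at a time. *)
suff H : forall s : seq I, forall g : I -> R -> R,
    (forall i, measurable_fun setT (g i)) -> (forall i x, 0 <= g i x) ->
    (forall i, \int[P]_w (g i (X i w))%:E \is a fin_num)%E ->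
    (forall i, i \notin s -> exists2 B, measurable B & g i = \1_B) ->
    (\int[P]_w (\prod_i g i (X i w))%:E =
     (\prod_i fine (\int[P]_w (g i (X i w))%:E))%:E)%E.
  by apply: (H (enum I)) => // i; rewrite mem_enum.
elim=> [|a s IH] g mg g0 gfin gind.
  have /choice[B HB] : forall i, exists B, measurable B /\ g i = \1_B.
    by move=> i; have [B mB gB] := gind i isT; exists B.
  have mXB i : measurable (X i @^-1` B i).
    by rewrite -[A in measurable A]setTI; apply: (measurable_funP (X i)) => //; case: (HB i).
  pose J : {set I} := finset.setTfor I.
  have inJ i : i \in J by rewrite finset.inE.
  transitivity (P (\bigcap_(i in [set i | i \in J]) (X i @^-1` B i))).
    rewrite -integral_indicT; last first.
      by apply: fin_bigcap_measurable => //; exact: finite_finset.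
    apply: eq_integral => w _; congr (_%:E).
    rewrite indicE; have [|] := boolP (w \in _).
      rewrite inE => wB; rewrite big1// => i _.
      by rewrite (HB i).2 indicE mem_set//; apply: wB => /=.
    rewrite notin_setE => /existsNP[i] /not_implyP[_ wi].
    by rewrite (bigD1 i)//= (HB i).2 indicE memNset// mul0r.
  rewrite indep; last by move=> i; case: (HB i).
  rewrite -prodEFin; apply: eq_big => [i|i _]; first by rewrite inJ.
  rewrite fineK// -[LHS]integral_indicT// (HB i).2.
  by apply: eq_integral => w _.
pose w x := \prod_(i | i != a) g i (X i x).
have mw : measurable_fun setT w.
  by apply: measurable_fun_prodr => i; exact: measurableT_comp.
have w0 x : 0 <= w x by apply: prodr_ge0 => i _; exact: g0.
pose c := \prod_(i | i != a) fine (\int[P]_x (g i (X i x))%:E)%E.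
transitivity (\int[P]_x ((g a (X a x))%:E * (w x)%:E))%E.
  by apply: eq_integral => x _; rewrite (bigD1 a)//= EFinM.
rewrite (@ge0_integral_weight _ _ _ _ _ P (distribution P (X a)) (X a) w c
  (EFin \o g a))//; last 3 first.
- move=> B mB.
  (* With an indicator at [a], the induction hypothesis for [s] applies. It says that the remaining
     factors, taken as the weight [w], turn the law of [X a] into [c] times itself. *)
  pose g' i := if i == a then \1_B else g i.
  have mXB : measurable (X a @^-1` B).
    by rewrite -[A in measurable A]setTI; apply: (measurable_funP (X a)).
  have E1 : (\int[P]_x (\1_B (X a x))%:E = P (X a @^-1` B))%E.
    by rewrite -integral_indicT.
  have := IH g' _ _ _ _; rewrite (bigD1 a)//= /g' eqxx E1.
  under eq_bigr => i ia do rewrite (negbTE ia).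
  move=> IH'; rewrite integral_mkcond epatch_indic.
  transitivity (fine (P (X a @^-1` B)) * c)%:E%E; last first.
    by rewrite EFinM fineK ?fin_num_measure// muleC.
  rewrite -IH'.
  + apply: eq_integral => x _; rewrite [in RHS](bigD1 a)//= eqxx [RHS]EFinM muleC.
    congr (_ * _%:E)%E.
    by apply: eq_bigr => i ia; rewrite (negbTE ia).
  + by move=> i; case: ifP => // _; exact: measurable_indic.
  + by move=> i x; case: ifP.
  + by move=> i; case: eqVneq => [->|_] //; rewrite E1 fin_num_measure.
  + move=> i is'; case: (eqVneq i a) => [_|ia]; first by exists B.
    by apply: gind; rewrite inE negb_or ia.
- exact/measurable_EFinP.
- by move=> y; rewrite lee_fin.
- rewrite (bigD1 a)//= -/c EFinM fineK// ge0_integral_distribution//.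
    by rewrite muleC.
  exact/measurable_EFinP.
- by move=> y; rewrite lee_fin.
Qed.

(** Markov's inequality for the exponential of the sum, whose mean factors by independence. The
    Chernoff parameter is absorbed into [f]. *)
Lemma chernoff_indep_sum (I : finType) (X : I -> {RV P >-> R})
    (f : I -> R -> R) (a b : R) :
  mutually_independent X -> (forall i, measurable_fun setT (f i)) ->
  (forall i, \int[P]_w (expR (f i (X i w)))%:E <= (expR b)%:E)%E ->
  (P [set w | a <= \sum_i f i (X i w)]%R <= (expR (b * #|I|%:R - a))%:E)%E.
Proof.
move=> indep mf fb.
have mexp i : measurable_fun setT (expR \o f i) by exact: measurableT_comp.
have fin i : (\int[P]_w (expR (f i (X i w)))%:E \is a fin_num)%E.
  rewrite ge0_fin_numE; first exact: le_lt_trans (fb i) (ltry _).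
  by apply: integral_ge0 => w _; rewrite lee_fin expR_ge0.
have mS : measurable_fun setT (fun w => \sum_i f i (X i w)).
  by apply: measurable_sum => i; exact: measurableT_comp.
have mE : measurable [set w | a <= \sum_i f i (X i w)]%R.
  rewrite -[A in measurable A]setTI.
  have -> : [set w | a <= \sum_i f i (X i w)]%R =
    (fun w => \sum_i f i (X i w)) @^-1` `[a, +oo[.
    by apply/seteqP; split => w /=; rewrite in_itv/= andbT.
  exact: mS.
rewrite -integral_indicT//.
apply: (@le_trans _ _ (\int[P]_w ((expR (- a))%:E * (\prod_i expR (f i (X i w)))%:E))%E).
  have mprod : measurable_fun setT (fun w => \prod_i expR (f i (X i w))).
    by apply: (@measurable_fun_prodr _ _ (fun i w => expR (f i (X i w)))) => i;
      exact: (measurableT_comp (mexp i)).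
  apply: ge0_le_integral => //.
  - by apply/measurable_EFinP; exact: measurable_indic.
  - by apply: emeasurable_funM => //; exact/measurable_EFinP.
  - move=> w _; rewrite -expR_sum -EFinM -expRD lee_fin indicE.
    have [|_] := boolP (w \in _); last by rewrite expR_ge0.
    by rewrite inE/= => aw; rewrite -expR0 ler_expR; lra.
rewrite ge0_integralZl_EFin//; last 2 first.
- by move=> w _; rewrite lee_fin; apply: prodr_ge0 => i _; exact: expR_ge0.
- apply/measurable_EFinP.
  by apply: (@measurable_fun_prodr _ _ (fun i w => expR (f i (X i w)))) => i;
    exact: (measurableT_comp (mexp i)).
rewrite (@expectation_prod_indep _ X (fun i => expR \o f i))//; last first.
  by move=> i x; exact: expR_ge0.
rewrite -EFinM lee_fin expRD mulrC ler_wpM2r ?expR_ge0//.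
apply: (@le_trans _ _ (\prod_(i : I) expR b)).
  apply: ler_prod => i _; apply/andP; split.
    by apply: fine_ge0; apply: integral_ge0 => w _; rewrite lee_fin expR_ge0.
  by rewrite -lee_fin fineK; [exact: fb|exact: fin].
by rewrite prodr_const -expRM_natr.
Qed.

End Independence.

(** * Exponential moments of functions of quadratic growth *)

Section Subexponential.
Context (R : realType).
Implicit Types x y K l : R.

(** For small [y] this follows from [(1 - y) * expR y <= 1]. Otherwise [y ^+ 2 >= 1/4], and 6 is 4 +
    2: [expR y] is at most 4 and [- y] at most 2 times [y ^+ 2 * expR |y|]. *)
Lemma expR_quadratic_ub y : expR y <= 1 + y + 6 * y ^+ 2 * expR `|y|.
Proof.
have e1 : 1 <= expR `|y| by rewrite -expR0 ler_expR.
have [y2|y2] := leP `|y| (2^-1).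
  have [yl yu] : - 2^-1 <= y /\ y <= 2^-1 by apply/andP; rewrite -ler_norml.
  have := expR_ge1Dx (- y); rewrite expRN => H.
  have Ey := expR_gt0 y.
  have : (1 - y) * expR y <= 1.
    by rewrite -[leRHS](mulVf (lt0r_neq0 Ey)) ler_pM2r.
  move=> H2.
  have : expR y <= 1 + y + 2 * y ^+ 2.
    have : 0 < 1 - y by lra.
    move=> H3; rewrite -(ler_pM2l H3) (le_trans H2)//.
    have -> : (1 - y) * (1 + y + 2 * y ^+ 2) = 1 + y ^+ 2 * (1 - 2 * y) by ring.
    by rewrite lerDl mulr_ge0 ?sqr_ge0//; lra.
  have : y ^+ 2 <= y ^+ 2 * expR `|y| by rewrite ler_peMr ?sqr_ge0.
  have := sqr_ge0 y; lra.
have ee : expR y <= expR `|y| by rewrite ler_expR ler_norm.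
have yy : `|y| ^+ 2 = y ^+ 2 by rewrite real_normK ?num_real.
have h1 : 4^-1 <= y ^+ 2 by rewrite -yy; nra.
have h2 : `|y| <= 2 * y ^+ 2 by rewrite -yy; nra.
have h3 : - `|y| <= y by rewrite lerNl -normrN ler_norm.
have h4 : y ^+ 2 <= y ^+ 2 * expR `|y| by rewrite ler_peMr ?sqr_ge0.
have h5 : 4^-1 * expR `|y| <= y ^+ 2 * expR `|y| by rewrite ler_wpM2r ?expR_ge0.
lra.
Qed.

Lemma sqr_le_expR y : 0 <= y -> y ^+ 2 <= 4 * expR y.
Proof.
move=> y0; have h : y / 2 <= expR (y / 2).
  by apply: le_trans (expR_ge1Dx _); rewrite lerDr.
have -> : expR y = expR (y / 2) ^+ 2 by rewrite -expRM_natr mulrVK// unitfE.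
have h0 : 0 <= y / 2 by rewrite divr_ge0.
have := expR_ge0 (y / 2); nra.
Qed.

(** Dominates functions of quadratic growth and their small exponentials, yet stays integrable
    against the normal law because 1/4 is below 1/2. *)
Definition gauss_weight x : R := expR ((1 + x ^+ 2) / 4).

Lemma gauss_weight_ge0 x : 0 <= gauss_weight x. Proof. exact: expR_ge0. Qed.

Lemma measurable_gauss_weight : measurable_fun setT gauss_weight.
Proof.
apply: measurableT_comp => //; apply: measurable_funM => //.
by apply: measurable_funD => //; exact: measurable_funX.
Qed.

Local Notation N := (normal_prob (0 : R) 1).

Lemma ge0_integral_normal (f : R -> R) :
  measurable_fun setT f -> (forall x, 0 <= f x) ->
  (\int[N]_x (f x)%:E = \int[lebesgue_measure]_x (f x * normal_pdf 0 1 x)%:E)%E.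
Proof.
move=> mf f0; rewrite -[LHS]mul1e.
rewrite -(@ge0_integral_weight _ _ _ _ _ lebesgue_measure N id (normal_pdf 0 1)
   1 (EFin \o f))//.
- exact: measurable_normal_pdf.
- by move=> x; exact: normal_pdf_ge0.
- by move=> B mB; rewrite mul1e.
- exact/measurable_EFinP.
Qed.

(** The weight times the standard normal density is a multiple of the normal density of variance
    2. *)
Lemma integral_gauss_weight_lty : (\int[N]_x (gauss_weight x)%:E < +oo)%E.
Proof.
have mw := measurable_gauss_weight.
rewrite ge0_integral_normal//; last exact: gauss_weight_ge0.
have s0 : Num.sqrt (2 : R) != 0 by rewrite gt_eqF ?sqrtr_gt0.
pose k : R := expR (4^-1) * normal_peak 1 / normal_peak (Num.sqrt 2).
apply: (@le_lt_trans _ _ (\int[lebesgue_measure]_x (k%:E * (normal_pdf 0 (Num.sqrt 2) x)%:E))%E).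
  rewrite le_eqVlt; apply/orP; left; apply/eqP.
  apply: eq_integral => x _; rewrite -EFinM; congr (_%:E).
  rewrite /normal_pdf oner_eq0 (negbTE s0) /k.
  have E : gauss_weight x * normal_fun 0 1 x =
      expR 4^-1 * normal_fun 0 (Num.sqrt 2) x.
    rewrite /gauss_weight /normal_fun sqr_sqrtr// -!expRD; congr expR.
    by rewrite expr1n subr0; field.
  rewrite mulrCA E; field.
  by rewrite gt_eqF ?normal_peak_gt0.
rewrite ge0_integralZl_EFin//.
- by rewrite integral_normal_pdf mule1 ltry.
- by move=> x _; rewrite lee_fin normal_pdf_ge0.
- by apply/measurable_EFinP; exact: measurable_normal_pdf.
- by rewrite /k !(mulr_ge0, invr_ge0, expR_ge0, normal_peak_ge0).
Qed.

(* The bound depends on f only through K. *)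
Lemma mgf_le : exists2 M : R, 0 < M & forall (d : measure_display)
    (T : measurableType d) (P : probability T R) (X : {RV P >-> R})
    (f : R -> R) K l,
  (forall B, measurable B -> P (X @^-1` B) = N B) ->
  measurable_fun setT f -> 0 < K -> (forall x, `|f x| <= K * (1 + x ^+ 2)) ->
  (\int[P]_w (f (X w))%:E = 0)%E -> 0 < l -> l * K <= 8^-1 ->
  (\int[P]_w (expR (l * f (X w)))%:E <= (expR (M * (l * K) ^+ 2))%:E)%E.
Proof.
have mw := measurable_gauss_weight; have w0 := gauss_weight_ge0.
pose G := fine (\int[N]_x (gauss_weight x)%:E)%E.
have GE : (\int[N]_x (gauss_weight x)%:E = G%:E)%E.
  rewrite fineK// ge0_fin_numE ?integral_gauss_weight_lty//.
  by apply: integral_ge0 => x _; rewrite lee_fin.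
have G0 : 0 <= G by apply: fine_ge0; apply: integral_ge0 => x _; rewrite lee_fin.
(* 1536 is 6 * 256: the 6 of [expR_quadratic_ub] times the constant in
   [u ^+ 2 <= 256 * expR (u / 8)]. The 1 is there for positivity. *)
exists (1536 * G + 1); first lra.
move=> d T P X f K l lawX mf K0 fK f_0 l0 lK.
have mX : measurable_fun setT X := measurable_funP X.
have mfX : measurable_fun setT (f \o X) by exact: measurableT_comp.
have mwX : measurable_fun setT (gauss_weight \o X) by exact: measurableT_comp.
have GXE : (\int[P]_w (gauss_weight (X w))%:E = G%:E)%E.
  by rewrite -GE; exact: ge0_integral_normal_law.
have IG : P.-integrable setT (fun w => (gauss_weight (X w))%:E).
  apply/integrableP; split; first exact/measurable_EFinP.
  by under eq_integral do rewrite /= ger0_norm//; rewrite GXE ltry.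
have If : P.-integrable setT (fun w => (f (X w))%:E).
  apply: (@le_integrable _ _ _ _ _ measurableT _
    (fun w => ((4 * K)%:E * (gauss_weight (X w))%:E)%E)).
  - exact/measurable_EFinP.
  - move=> w _ /=; set x := X w; rewrite lee_fin (le_trans (fK x))// ger0_norm; last first.
      by rewrite mulr_ge0 ?w0// mulr_ge0 ?ltW.
    rewrite [4 * K]mulrC -mulrA ler_wpM2l ?ltW// /gauss_weight.
    have := expR_ge1Dx ((1 + x ^+ 2) / 4); lra.
  - by apply: integrableZl => //; exact: IG.
pose c := 1536 * (l * K) ^+ 2.
have c0 : 0 <= c := mulr_ge0 (ler0n _ _) (sqr_ge0 _).
(* After integration the linear term vanishes because [f] is centered, and [1 + c * G] is bounded by
   an exponential. *)
apply: (@le_trans _ _ (\int[P]_w ((1 + l * f (X w))%:E + (c * gauss_weight (X w))%:E))%E).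
  apply: ge0_le_integral => //.
  - by apply/measurable_EFinP; apply: measurableT_comp => //; exact: measurable_funM.
  - apply: emeasurable_funD; apply/measurable_EFinP; last exact: measurable_funM.
    by apply: measurable_funD => //; exact: measurable_funM.
  - move=> w _; set x := X w; rewrite -EFinD lee_fin (le_trans (expR_quadratic_ub _))// lerD2l.
    set u := 1 + x ^+ 2.
    have u1 : 1 <= u by rewrite /u lerDl sqr_ge0.
    have lf : `|l * f x| <= l * K * u.
      by rewrite normrM (gtr0_norm l0) -mulrA ler_pM2l.
    (* The bound 1/8 on [l * K] serves here: half of the exponent of [gauss_weight] covers
       [expR |l * f x|], the other half absorbs the square. *)
    have lf8 : `|l * f x| <= u / 8 by nra.
    have sq : (l * f x) ^+ 2 <= (l * K) ^+ 2 * u ^+ 2.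
      by rewrite -[X in X <= _]real_normK ?num_real// -exprMn; apply: lerXn2r;
        rewrite ?nnegrE// mulr_ge0 ?mulr_ge0//; lra.
    have u8 : u ^+ 2 <= 256 * expR (u / 8).
      have /sqr_le_expR : 0 <= u / 8 by lra.
      rewrite expr_div_n; lra.
    rewrite /gauss_weight -/u.
    have -> : expR (u / 4) = expR (u / 8) * expR (u / 8).
      by rewrite -expRD; congr expR; field.
    have ele : expR `|l * f x| <= expR (u / 8) by rewrite ler_expR.
    have -> : c * (expR (u / 8) * expR (u / 8)) =
      6 * ((l * K) ^+ 2 * (256 * expR (u / 8))) * expR (u / 8) by rewrite /c; ring.
    have h1 : (l * f x) ^+ 2 <= (l * K) ^+ 2 * (256 * expR (u / 8)).
      by apply: (le_trans sq); rewrite ler_wpM2l ?sqr_ge0.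
    apply: ler_pM; [|exact: expR_ge0| |exact: ele].
      exact: (mulr_ge0 (ler0n _ _) (sqr_ge0 _)).
    by rewrite -(ler_pM2l (ltr0n _ 6)) in h1.
have I1 : P.-integrable setT (fun w => (1 + l * f (X w))%:E).
  under eq_fun do rewrite EFinD EFinM.
  apply: integrableD => //; first exact: finite_measure_integrable_cst.
  by apply: integrableZl.
have I2 : P.-integrable setT (fun w => (c * gauss_weight (X w))%:E).
  under eq_fun do rewrite EFinM.
  by apply: integrableZl => //; exact: IG.
rewrite integralD//.
under eq_integral do rewrite EFinD EFinM.
rewrite integralD//; last 2 first.
- exact: finite_measure_integrable_cst.
- by apply: integrableZl.
rewrite integralZl// f_0 mule0 adde0 integral_cst//.
under eq_integral do rewrite EFinM.
rewrite integralZl//.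
rewrite GXE [X in (X + _)%E](_ : _ = 1%E); last first.
  by rewrite mul1e; exact: probability_setT.
rewrite -EFinM -EFinD lee_fin.
apply: le_trans (expR_ge1Dx _); rewrite lerD2l /c.
have := sqr_ge0 (l * K); nra.
Qed.

End Subexponential.

Set Implicit Arguments.
Unset Strict Implicit.

(** * The filter of overwhelming probability *)

Section Overwhelming.
Context (R : realType) (d : measure_display) (T : measurableType d)
  (P : probability T R) (n : nat -> nat) (n_oo : n @ \oo --> \oo).

Lemma probability_setC_le (E : set T) (x : R) : measurable E ->
  ((1 - x)%:E <= P E)%E -> (P (~` E) <= x%:E)%E.
Proof.
move=> mE; rewrite probability_setC//.
have [p ->] : exists p, P E = p%:E.
  by exists (fine (P E)); rewrite fineK// fin_num_measure.
by rewrite -EFinB !lee_fin; lra.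
Qed.

Lemma le_probability_setC (E : set T) (x : R) : measurable E ->
  (P (~` E) <= x%:E)%E -> ((1 - x)%:E <= P E)%E.
Proof.
move=> mE; rewrite probability_setC//.
have [p ->] : exists p, P E = p%:E.
  by exists (fine (P E)); rewrite fineK// fin_num_measure.
by rewrite -EFinB !lee_fin; lra.
Qed.

(* Events of overwhelming probability form a filter on the pairs (index of the
   problem, sample point), so that concentration is convergence along it. *)
Definition ow : set_system (nat * T) :=
  fun S => overwhelming P n (fun j => [set w | S (j, w)]).

Lemma near_nat_ge (a : R) : \forall j \near \oo, a <= (n j)%:R.
Proof.
near=> j.
have : ((Num.trunc `|a|).+1 <= n j)%N.
  by near: j; exact: (@n_oo _ (nbhs_infty_ge (Num.trunc `|a|).+1)).
rewrite -(ler_nat R); apply: le_trans.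
by rewrite (le_trans (ler_norm a))// ltW// truncnS_gt.
Unshelve. all: by end_near.
Qed.

Lemma ow_filter : Filter ow.
Proof.
split.
- exists 1 => //; apply: nearW => j; exists setT; split => //.
  rewrite probability_setT lee_fin lerBlDr lerDl; exact: expR_ge0.
- move=> S1 S2 [c1 c10 H1] [c2 c20 H2].
  have c0 : 0 < Num.min c1 c2 by rewrite lt_min c10.
  exists (Num.min c1 c2 / 2); first by rewrite divr_gt0.
  near=> j.
  have [E1 [mE1 ES1 PE1]] : exists E : set T, [/\ measurable E,
    E `<=` [set w | S1 (j, w)] & ((1 - expR (- c1 * (n j)%:R))%:E <= P E)%E].
    by near: j.
  have [E2 [mE2 ES2 PE2]] : exists E : set T, [/\ measurable E,
    E `<=` [set w | S2 (j, w)] & ((1 - expR (- c2 * (n j)%:R))%:E <= P E)%E].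
    by near: j.
  exists (E1 `&` E2); split; first exact: measurableI.
    by move=> w [? ?]; split; [exact: ES1|exact: ES2].
  have nj : 2 / Num.min c1 c2 <= (n j)%:R by near: j; exact: near_nat_ge.
  set c := Num.min c1 c2 in c0 nj *.
  have cn : 2 <= (n j)%:R * c by rewrite -ler_pdivrMr.
  have e1 : expR (- c1 * (n j)%:R) <= expR (- c * (n j)%:R).
    by rewrite ler_expR !mulNr lerN2 ler_wpM2r// ge_min lexx.
  have e2 : expR (- c2 * (n j)%:R) <= expR (- c * (n j)%:R).
    by rewrite ler_expR !mulNr lerN2 ler_wpM2r// ge_min lexx orbT.
  have e3 : 2 * expR (- c * (n j)%:R) <= expR (- (c / 2) * (n j)%:R).
    have -> : - c * (n j)%:R = - (c / 2) * (n j)%:R + - (c / 2) * (n j)%:R by field.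
    rewrite expRD mulrA ler_piMl ?expR_ge0//.
    have : expR (- (c / 2) * (n j)%:R) <= expR (- 1) by rewrite ler_expR; lra.
    have := expR_ge1Dx (1 : R); rewrite expRN => h1.
    have : (expR (1:R))^-1 <= 2^-1 by rewrite lef_pV2 ?posrE ?expR_gt0//; lra.
    lra.
  have mE12 : measurable (E1 `&` E2) by exact: measurableI.
  apply: le_probability_setC => //; rewrite setCI; apply: (@le_trans _ _ (P (~` E1) + P (~` E2))%E).
    by apply: measureU2; exact: measurableC.
  apply: (@le_trans _ _ ((expR (- c * (n j)%:R))%:E + (expR (- c * (n j)%:R))%:E)%E).
    apply: leeD; apply: probability_setC_le => //.
      by apply: le_trans PE1; rewrite lee_fin; lra.
    by apply: le_trans PE2; rewrite lee_fin; lra.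
  by rewrite -EFinD lee_fin; lra.
- move=> S1 S2 S12 [c c0 H]; exists c => //; apply: filterS H => j [E [mE ES PE]].
  by exists E; split => // w /ES; exact: S12.
Unshelve. all: by end_near.
Qed.

Lemma cvg_fst_ow : fst @ ow --> \oo.
Proof.
move=> S SN; exists 1 => //; apply: filterS SN => j Sj; exists setT; split => //.
by rewrite probability_setT lee_fin lerBlDr lerDl; exact: expR_ge0.
Qed.

Lemma cvg_ow (u : nat -> R) (l : R) : u @ \oo --> l -> (fun p => u p.1) @ ow --> l.
Proof. by move=> ul; apply: cvg_comp cvg_fst_ow ul. Qed.

#[local] Existing Instance ow_filter.

(** The bound [K] on the growth of the summands is uniform in [j] and [i], so a single Chernoff
    parameter serves all dimensions. *)
Lemma concentration (I : nat -> finType) (X : forall j, I j -> {RV P >-> R})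
    (f : forall j, I j -> R -> R) (C K : R) :
  0 < C -> 0 < K ->
  (\forall j \near \oo, #|I j|%:R <= C * (n j)%:R) ->
  (forall j, indep_normal (fun=> 1) (X j)) ->
  (forall j i, measurable_fun setT (f j i)) ->
  (forall j i x, `|f j i x| <= K * (1 + x ^+ 2)) ->
  (forall j i, \int[P]_w (f j i (X j i w))%:E = 0)%E ->
  (fun p => (\sum_i f p.1 i (X p.1 i p.2)) / (n p.1)%:R) @ ow --> (0 : R).
Proof.
move=> C0 K0 IC indep.
have [M M0 mgf] := mgf_le R.
(* The upper deviation suffices: the lower one is the same bound for [- f]. *)
suff upper e (f' : forall j, I j -> R -> R) : 0 < e ->
  (forall j i, measurable_fun setT (f' j i)) ->
  (forall j i x, `|f' j i x| <= K * (1 + x ^+ 2)) ->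
  (forall j i, \int[P]_w (f' j i (X j i w))%:E = 0)%E ->
  ow [set p | (\sum_i f' p.1 i (X p.1 i p.2)) / (n p.1)%:R <= e].
  move=> mf fK f_0; apply/cvgrPdist_le => e e0.
  have U1 := upper e f e0 mf fK f_0.
  have U2 : ow [set p | (\sum_i - f p.1 i (X p.1 i p.2)) / (n p.1)%:R <= e].
    apply: (upper e (fun j i x => - f j i x)) => //.
    - by move=> j i; exact: measurableT_comp.
    - by move=> j i x; rewrite normrN.
    - move=> j i; under eq_integral do rewrite EFinN.
      (* [integralN] requires the difference of the two parts to be defined. It is, since the
         difference of two infinities is by convention infinite and not 0. *)
      have H (a b : \bar R) : (0 <= a -> 0 <= b -> a - b = 0 -> a +? - b)%E.
        by move: a b => [a| |] [b| |].
      rewrite integralN ?f_0 ?oppe0//; apply: H; last by rewrite -integralE.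
        by apply: integral_ge0 => w _; exact: funepos_ge0.
      by apply: integral_ge0 => w _; exact: funeneg_ge0.
  apply: filterS2 U1 U2 => p /= h1 h2.
  by rewrite sub0r normrN ler_norml h1 andbT lerNl -mulNr -sumrN.
move=> e0 mf fK f_0.
(* The first bound is the range of [mgf_le]. The second makes the quadratic term
   [M * (l * K) ^+ 2 * C * n] at most half of [l * e * n], which leaves the rate [l * e / 2]. *)
pose l := Num.min (8 * K)^-1 (e / (2 * M * K ^+ 2 * C)).
have MKC : 0 < 2 * M * K ^+ 2 * C by rewrite !mulr_gt0 ?exprn_gt0.
have l0 : 0 < l by rewrite lt_min invr_gt0 divr_gt0// !mulr_gt0.
have l1 : l * K <= 8^-1.
  rewrite -ler_pdivlMr// -invfM ge_min lexx//.
have l2 : l * (2 * M * K ^+ 2 * C) <= e.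
  by rewrite -ler_pdivlMr// ge_min lexx orbT.
exists (l * e / 2); first by rewrite divr_gt0 ?mulr_gt0.
near=> j.
have Ij : #|I j|%:R <= C * (n j)%:R by near: j.
have n1 : 1 <= (n j)%:R :> R by near: j; exact: near_nat_ge.
have n0 : 0 < (n j)%:R :> R by lra.
pose S w := \sum_i (l * f' j i (X j i w)).
have mS : measurable_fun setT S.
  apply: measurable_sum => i; apply: measurable_funM => //.
  exact: measurableT_comp.
have mE : measurable [set w | l * e * (n j)%:R <= S w].
  have -> : [set w | l * e * (n j)%:R <= S w] =
    setT `&` S @^-1` `[l * e * (n j)%:R, +oo[.
    by apply/seteqP; split => w /=; rewrite in_itv/= andbT// => -[].
  exact: mS.
exists (~` [set w | l * e * (n j)%:R <= S w]); split.
- exact: measurableC.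
- move=> w /= /negP; rewrite -ltNge /S -mulr_sumr -mulrA ltr_pM2l// => /ltW.
  by rewrite ler_pdivrMr.
- rewrite probability_setC// EFinB leeB//.
  have [indepj lawj] := indep j.
  apply: (le_trans (@chernoff_indep_sum _ _ _ _ _ _
     (fun i x => l * f' j i x) _ (M * (l * K) ^+ 2) indepj _ _)).
  + by move=> i; apply: measurable_funM.
  + by move=> i; apply: mgf => //; exact: lawj.
  rewrite lee_fin ler_expR.
  have h1 : M * (l * K) ^+ 2 * #|I j|%:R <= M * (l * K) ^+ 2 * (C * (n j)%:R).
    by rewrite ler_wpM2l// mulr_ge0 ?sqr_ge0// ltW.
  have h2 : l * (l * (2 * M * K ^+ 2 * C)) * (n j)%:R <= l * e * (n j)%:R.
    by rewrite ler_pM2r// ler_pM2l.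
  lra.
Unshelve. all: by end_near.
Qed.

End Overwhelming.

(** * Normal moments and the error function *)

Section PointwiseDerivatives.
Context (R : realType).
Implicit Types (f g : R -> R) (x df dg : R).

Lemma is_derive1_const (c x : R) : is_derive x 1 (fun=> c) 0.
Proof. exact: is_derive_cst. Qed.

Lemma is_derive1_add f g x df dg : is_derive x 1 f df -> is_derive x 1 g dg ->
  is_derive x 1 (fun y => f y + g y) (df + dg).
Proof. exact: is_deriveD. Qed.

Lemma is_derive1_sub f g x df dg : is_derive x 1 f df -> is_derive x 1 g dg ->
  is_derive x 1 (fun y => f y - g y) (df - dg).
Proof. exact: is_deriveB. Qed.

Lemma is_derive1_mul f g x df dg : is_derive x 1 f df -> is_derive x 1 g dg ->
  is_derive x 1 (fun y => f y * g y) (f x * dg + g x * df).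
Proof. exact: is_deriveM. Qed.

Lemma is_derive1_mulr (c : R) f x df : is_derive x 1 f df ->
  is_derive x 1 (fun y => c * f y) (c * df).
Proof. exact: is_deriveZ. Qed.

Lemma is_derive1_sqr (x : R) : is_derive x 1 (fun y => y ^+ 2) (2 * x).
Proof.
have := is_derive1_mul (is_derive_id x 1) (is_derive_id x 1).
by rewrite !mulr1 -mulr2n mulr_natl.
Qed.

Lemma is_derive1_chain f g x df dg : is_derive (g x) 1 f df ->
  is_derive x 1 g dg -> is_derive x 1 (fun y => f (g y)) (df * dg).
Proof. by move=> hf hg; have := is_derive1_comp hf hg; rewrite mulrC. Qed.

Lemma is_derive1_eq f x (df dg : R) : is_derive x 1 f df -> df = dg ->
  is_derive x 1 f dg.
Proof. by move=> + <-. Qed.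

End PointwiseDerivatives.

(** * The error function, the normal density and truncated second moments *)

Section ErrorFunctionCalculus.
Import gauss_integral_proof.
Context (R : realType).
Implicit Types x y t : R.
Local Notation mu := lebesgue_measure.

Let gauss_cdf x : R := \int[mu]_(t in `]-oo, x]) gauss_fun t.

Let gauss_itv (i : interval R) : mu.-integrable [set` i] (EFin \o @gauss_fun R).
Proof.
by apply: (@integrableS _ _ _ _ setT) => //; exact: integrableT_gauss.
Qed.

(** Integrating from minus infinity merges the two orientations, so that one application of the
    fundamental theorem of calculus differentiates [erf] everywhere, including at 0. *)
Lemma erfE x : erf x = 2 / Num.sqrt pi * (gauss_cdf x - gauss_cdf 0).
Proof.
rewrite /erf; congr (_ * _); case: ifPn => [x0|]; last rewrite -ltNge => x0.
  rewrite /gauss_cdf Rintegral_itvB//.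
  by rewrite Rintegral_itv_obnd_cbnd.
rewrite -opprB; congr (- _); rewrite /gauss_cdf Rintegral_itvB ?bnd_simp ?ltW//.
by rewrite Rintegral_itv_obnd_cbnd.
Qed.

Global Instance is_derive_erf x :
  is_derive x 1 (@erf R) (2 / Num.sqrt pi * expR (- x ^+ 2)).
Proof.
have -> : @erf R = (fun x => 2 / Num.sqrt pi * (gauss_cdf x - gauss_cdf 0)).
  by apply/funext => y; exact: erfE.
have [dG G'] : derivable gauss_cdf x 1 /\ (gauss_cdf^`() x)%classic = gauss_fun x.
  apply: (@continuous_FTC1 R _ _ _ (x + 1)) => //; first by rewrite ltrDl.
    by rewrite ltNyr.
  exact: continuous_gauss_fun.
have dG' : is_derive x 1 gauss_cdf (expR (- x ^+ 2)).
  by apply: DeriveDef => //; rewrite -derive1E.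
have := is_derive1_mulr (2 / Num.sqrt pi) (is_derive1_sub dG' (is_derive1_const (gauss_cdf 0) x)).
by rewrite subr0.
Qed.

Lemma erf0 : erf 0 = 0 :> R.
Proof. by rewrite erfE subrr mulr0. Qed.

Lemma erfN x : erf (- x) = - erf x.
Proof.
have : erf x + erf (- x) = erf 0 + erf (- 0).
  apply: (@is_derive_0_is_cst _ (fun y => erf y + erf (- y))) => y.
  have dN : is_derive y 1 (fun z : R => - z) (- 1) := is_deriveNid y 1.
  apply: (is_derive1_eq (is_derive1_add (is_derive_erf y)
    (is_derive1_chain (is_derive_erf (- y)) dN))).
  by rewrite sqrrN; ring.
by rewrite oppr0 erf0 addr0 => /eqP; rewrite addrC addr_eq0 => /eqP.
Qed.

Lemma cvg_erf : (@erf R) y @[y --> +oo] --> (1 : R).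
Proof.
have p0 : 0 < Num.sqrt (pi : R) by rewrite sqrtr_gt0 pi_gt0.
have -> : (1 : R) = 2 / Num.sqrt pi * (Num.sqrt (pi / 4)).
  rewrite sqrtrM ?pi_ge0// sqrtrV//.
  have -> : (4 : R) = 2 ^+ 2 by rewrite -natrX.
  by rewrite sqrtr_sqr ger0_norm//; field; rewrite gt_eqF.
(* The known limit [pi / 4] is that of the squared integral; the integral is nonnegative, so the
   square root recovers it. *)
apply: cvg_trans (_ : (2 / Num.sqrt pi * Num.sqrt ((@integral0_gauss R) y ^+ 2)) @[y --> +oo] --> _).
  apply: near_eq_cvg; near=> y.
  have y0 : 0 <= y by near: y; apply: nbhs_pinfty_ge; rewrite num_real.
  by rewrite sqrtr_sqr ger0_norm ?integral0_gauss_ge0// /erf y0.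
apply: cvgMr; apply: continuous_cvg; first exact: sqrt_continuous.
exact: cvg_integral0_gauss_sqr.
Unshelve. all: by end_near. Qed.

Definition gdens y : R := normal_pdf 0 1 y.

Lemma gdensE y : gdens y = expR (- y ^+ 2 / 2) / Num.sqrt (2 * pi).
Proof.
rewrite /gdens /normal_pdf oner_eq0 /normal_peak /normal_fun expr1n subr0 mul1r.
have -> : pi *+ 2 = 2 * pi :> R by rewrite mulr_natl.
by rewrite mulrC.
Qed.

Global Instance is_derive_gdens y : is_derive y 1 gdens (- y * gdens y).
Proof.
have -> : gdens = (fun y => expR (- y ^+ 2 / 2) / Num.sqrt (2 * pi)).
  by apply/funext => z; exact: gdensE.
have h := is_derive1_mulr (- 2^-1) (is_derive1_sqr y).
have := is_derive1_mulr (Num.sqrt (2 * pi))^-1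
  (@is_derive1_chain _ expR (fun z => - 2^-1 * z ^+ 2) y _ _ (is_derive_expR _) h).
have -> : (fun z => (Num.sqrt (2 * pi))^-1 * expR (- 2^-1 * z ^+ 2)) =
    (fun z : R => expR (- z ^+ 2 / 2) / Num.sqrt (2 * pi)).
  by apply/funext => z; rewrite mulrC; congr (expR _ / _); ring.
move/is_derive1_eq; apply.
have -> : - y ^+ 2 / 2 = - 2^-1 * y ^+ 2 by ring.
by field; rewrite gt_eqF ?sqrtr_gt0 ?mulr_gt0 ?pi_gt0.
Qed.

Lemma gdens_gt0 y : 0 < gdens y.
Proof. by rewrite gdensE divr_gt0 ?expR_gt0// sqrtr_gt0 mulr_gt0 ?pi_gt0. Qed.

Lemma is_derive_erf_sqrt2 y :
  is_derive y 1 (fun z => erf (z / Num.sqrt 2)) (2 * gdens y).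
Proof.
have h : is_derive y 1 (fun z : R => z / Num.sqrt 2) (Num.sqrt 2)^-1.
  have := is_derive1_mulr (Num.sqrt 2)^-1 (is_derive_id y 1); rewrite mulr1.
  by under eq_fun do rewrite mulrC.
apply: (is_derive1_eq (is_derive1_chain (is_derive_erf _) h)).
rewrite gdensE sqrtrM// expr_div_n sqr_sqrtr// -mulNr.
field; rewrite !gt_eqF ?sqrtr_gt0 ?pi_gt0//.
Qed.

(** The shape in which the density occurs in [Cp]. *)
Lemma gdens_sqrt_pi y :
  gdens y = Num.sqrt (1 / (2 * pi)) * expR (- (y / Num.sqrt 2) ^+ 2).
Proof.
rewrite gdensE expr_div_n sqr_sqrtr// [RHS]mulrC div1r sqrtrV; last first.
  by rewrite mulr_ge0 ?pi_ge0.
by congr (expR _ * _); ring.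
Qed.

Lemma cvg_mul_gdens t : (y - 2 * t) * gdens y @[y --> +oo] --> (0 : R).
Proof.
have p0 : 0 < Num.sqrt (2 * pi : R) by rewrite sqrtr_gt0 mulr_gt0 ?pi_gt0.
(* For [y >= 1], [|y - 2 * t| <= (1 + 2 * |t|) * y], and [y ^+ 4 * expR (- y ^+ 2 / 2) <= 16] by
   [sqr_le_expR]. The product is then at most [K / y]. *)
pose K := (1 + 2 * `|t|) * 16 / Num.sqrt (2 * pi).
have K0 : 0 <= K.
  by rewrite divr_ge0 ?ltW// mulr_ge0// addr_ge0// mulr_ge0.
apply/cvgrPdist_le => e e0; near=> y.
have y1 : 1 <= y by near: y; apply: nbhs_pinfty_ge; rewrite num_real.
have yK : K / e <= y by near: y; apply: nbhs_pinfty_ge; rewrite num_real.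
have y0 : 0 < y by lra.
rewrite sub0r normrN normrM (gtr0_norm (gdens_gt0 _)) gdensE.
have h1 : `|y - 2 * t| <= (1 + 2 * `|t|) * y.
  rewrite (le_trans (ler_normB _ _))// (gtr0_norm y0) normrM (@ger0_norm _ 2)//.
  have := normr_ge0 t; nra.
have h2 : y ^+ 4 * expR (- y ^+ 2 / 2) <= 16.
  have /sqr_le_expR : 0 <= y ^+ 2 / 2 by rewrite divr_ge0 ?sqr_ge0.
  rewrite mulNr expRN ler_pdivrMr ?expR_gt0//.
  have -> : (y ^+ 2 / 2) ^+ 2 = y ^+ 4 / 4 by field.
  lra.
have h3 : y * expR (- y ^+ 2 / 2) <= 16 / y.
  rewrite ler_pdivlMr//; apply: le_trans h2.
  rewrite mulrAC ler_wpM2r ?expR_ge0//.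
  have -> : y ^+ 4 = y * y * y ^+ 2 by ring.
  by apply: ler_peMr; [exact: mulr_ge0 (ltW y0) (ltW y0)|nra].
apply: (@le_trans _ _ (K / y)); last first.
  by rewrite ler_pdivrMr// mulrC -ler_pdivrMr.
rewrite mulrA ler_pdivrMr//.
have -> : K / y * Num.sqrt (2 * pi) = (1 + 2 * `|t|) * (16 / y).
  by rewrite /K; field; rewrite !gt_eqF.
apply: (@le_trans _ _ ((1 + 2 * `|t|) * y * expR (- y ^+ 2 / 2))).
  by rewrite ler_wpM2r ?expR_ge0.
by rewrite -mulrA ler_wpM2l// addr_ge0// mulr_ge0.
Unshelve. all: by end_near. Qed.

(* E (min (X + t) 0)^2 for a standard normal X. *)
Definition tail2 t : R := (1 + t ^+ 2) * (1 - erf (t / Num.sqrt 2)) / 2 - t * gdens t.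

Lemma integral_tail2 t :
  (\int[mu]_(y in `[t, +oo[) ((y - t) ^+ 2 * gdens y)%:E = (tail2 t)%:E)%E.
Proof.
(* A primitive of the integrand: the derivative of gdens y is - y gdens y. *)
pose F y := - ((y - 2 * t) * gdens y) + (1 + t ^+ 2) / 2 * erf (y / Num.sqrt 2).
have dF y : is_derive y 1 F ((y - t) ^+ 2 * gdens y).
  have h := is_derive1_sub (is_derive_id y 1) (is_derive1_const (2 * t) y).
  have h1 := is_derive1_mulr (- 1) (is_derive1_mul h (is_derive_gdens y)).
  have := is_derive1_add h1 (is_derive1_mulr ((1 + t ^+ 2) / 2) (is_derive_erf_sqrt2 y)).
  have -> : (fun z => -1 * ((id z - 2 * t) * gdens z) +
      (1 + t ^+ 2) / 2 * erf (z / Num.sqrt 2)) = F.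
    by apply/funext => z; rewrite mulN1r.
  by move/is_derive1_eq; apply; rewrite /=; field.
have cF : continuous F.
  by move=> y; apply: differentiable_continuous; apply/derivable1_diffP;
    case: (dF y).
have cg : continuous gdens.
  by move=> y; apply: differentiable_continuous; apply/derivable1_diffP;
    case: (is_derive_gdens y).
rewrite (@ge0_continuous_FTC2y R _ F t ((1 + t ^+ 2) / 2)).
- by rewrite -EFinB; congr (_%:E); rewrite /F /tail2; field.
- by move=> y _; exact: mulr_ge0 (sqr_ge0 _) (ltW (gdens_gt0 _)).
- apply: continuous_subspaceT => y; apply: cvgM; last exact: cg.
  apply: (@continuous_comp _ _ _ (fun z : R => z - t) (fun z => z ^+ 2)).
    by apply: cvgB; [exact: cvg_id|exact: cvg_cst].
  exact: exprn_continuous.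
- rewrite -[X in _ --> X]add0r -[X in _ --> 0 + X]mulr1 -oppr0.
  apply: cvgD; first by apply: cvgN; exact: cvg_mul_gdens.
  apply: cvgMr; apply: cvg_comp cvg_erf.
  by apply: gt0_cvgMly; [rewrite invr_gt0 sqrtr_gt0|exact: cvg_id].
- by move=> y _; case: (dF y).
- by apply: cvg_at_right_filter; exact: cF.
- by move=> y _; rewrite derive1E; case: (dF y).
Qed.

Lemma integral_oppr (f : R -> R) : measurable_fun setT f -> (forall y, 0 <= f y) ->
  (\int[mu]_y (f (- y))%:E = \int[mu]_y (f y)%:E)%E.
Proof.
move=> mf f0.
rewrite -[RHS]mul1e -(@ge0_integral_weight _ _ (measurableTypeR R)
  (measurableTypeR R) R mu mu (-%R) (cst 1) 1 (EFin \o f))//.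
- by apply: eq_integral => y _; rewrite mule1.
- move=> B mB; have mNB : measurable (-%R @^-1` B : set (measurableTypeR R)).
    by rewrite -[A in measurable A]setTI; exact: oppr_measurable.
  rewrite -[LHS]/(\int[mu]_(x in -%R @^-1` B) (cst 1%E x))%E.
  by rewrite integral_cst// !mul1e; exact: lebesgue_measureN.
- exact/measurable_EFinP.
Qed.

Section NormalMoments.
Context (d : measure_display) (T : measurableType d) (P : probability T R)
  (X : {RV P >-> R})
  (lawX : forall B : set R, measurable B -> P (X @^-1` B) = normal_prob 0 1 B).

Lemma expectation_normal_gdens (f : R -> R) :
  measurable_fun setT f -> (forall x, 0 <= f x) ->
  (\int[P]_w (f (X w))%:E = \int[mu]_y (f y * gdens y)%:E)%E.
Proof.
by move=> mf f0; rewrite ge0_integral_normal_law// ge0_integral_normal.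
Qed.

Lemma integral_tail2_patch t :
  (\int[mu]_y (Num.min (t - y) 0 ^+ 2 * gdens y)%:E = (tail2 t)%:E)%E.
Proof.
rewrite -integral_tail2 [RHS]integral_mkcond; apply: eq_integral => y _.
rewrite patchE; case: ifPn; rewrite ?inE ?notin_setE/= in_itv/= andbT.
  move=> ty; rewrite min_l ?subr_le0//; congr ((_ * _)%:E); ring.
by move/negP; rewrite -ltNge => yt; rewrite min_r ?subr_ge0 1?ltW// expr0n mul0r.
Qed.

Lemma measurable_min_sqr t : measurable_fun setT (fun x : R => Num.min (x + t) 0 ^+ 2).
Proof.
apply: measurable_funX; apply: measurable_minr => //.
exact: measurable_funD.
Qed.

Lemma expectation_normal_min t :
  (\int[P]_w (Num.min (X w + t) 0 ^+ 2)%:E = (tail2 t)%:E)%E.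
Proof.
rewrite (expectation_normal_gdens (measurable_min_sqr t)); last first.
  by move=> x; exact: sqr_ge0.
have mg : measurable_fun setT gdens := measurable_normal_pdf 0 1.
rewrite -integral_oppr; last 2 first.
- by apply: measurable_funM => //; exact: measurable_min_sqr.
- by move=> y; exact: mulr_ge0 (sqr_ge0 _) (ltW (gdens_gt0 _)).
rewrite -integral_tail2_patch; apply: eq_integral => y _.
by rewrite addrC !gdensE sqrrN.
Qed.

(** The square is the sum of the squared negative parts of [X + t] and [- (X + t)], whose means are
    [tail2 t] and [tail2 (- t)]. The error functions and densities cancel by parity. *)
Lemma expectation_normal_sqr t :
  (\int[P]_w ((X w + t) ^+ 2)%:E = (1 + t ^+ 2)%:E)%E.
Proof.
have mg : measurable_fun setT gdens := measurable_normal_pdf 0 1.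
have mX : measurable_fun setT X := measurable_funP X.
transitivity (\int[P]_w ((Num.min (X w + t) 0 ^+ 2)%:E
   + (Num.min (- t - X w) 0 ^+ 2)%:E))%E.
  apply: eq_integral => w _; rewrite -EFinD; congr (_%:E).
  by have [h|h] := leP (X w + t) 0;
    [rewrite [Num.min (- t - _) _]min_r|rewrite [Num.min (- t - _) _]min_l];
    try lra; ring.
have mf : measurable_fun setT (fun x : R => Num.min (- t - x) 0 ^+ 2).
  apply: measurable_funX; apply: measurable_minr => //.
  exact: measurable_funB.
rewrite ge0_integralD//; last 4 first.
- by move=> w _; rewrite lee_fin sqr_ge0.
- by apply/measurable_EFinP; exact: (measurableT_comp (measurable_min_sqr t)).
- by move=> w _; rewrite lee_fin sqr_ge0.
- by apply/measurable_EFinP; exact: (measurableT_comp mf).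
rewrite expectation_normal_min (expectation_normal_gdens mf); last first.
  by move=> x; exact: sqr_ge0.
rewrite integral_tail2_patch -EFinD; congr (_%:E).
by rewrite /tail2 mulNr erfN !gdensE sqrrN; field; rewrite gt_eqF ?sqrtr_gt0 ?mulr_gt0 ?pi_gt0.
Qed.

End NormalMoments.

End ErrorFunctionCalculus.

(** * The limiting optimization problem *)

Section LimitFunction.
Context (R : realType) (beta : R) (beta01 : 0 < beta < 1).
Implicit Types t s alpha sigma rsc theta : R.

(** The sign condition places [c] between [a] and [b] in whichever order they come, which spares a
    case distinction in every use. *)
Lemma mean_value (f df : R -> R) (a b : R) :
  (forall x : R, is_derive x 1 f (df x)) ->
  exists2 c, 0 <= (c - a) * (b - c) & f b - f a = df c * (b - a).
Proof.
move=> fdf; have cf : continuous f.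
  by move=> y; apply: differentiable_continuous; apply/derivable1_diffP;
    case: (fdf y).
wlog ab : a b / a <= b.
  move=> H; case/orP: (le_total a b) => [/H//|/H[c c0 cE]]; exists c.
    by move: c0; rewrite -mulrNN !opprB mulrC.
  by rewrite -opprB cE -mulrN opprB.
have [c] := MVT_segment ab (fun x _ => fdf x) (continuous_subspaceT cf).
rewrite in_itv/= => /andP[ac cb] cE; exists c => //.
by rewrite mulr_ge0 ?subr_ge0.
Qed.

Lemma erf_le1 (x : R) : erf x <= 1.
Proof.
apply: (cvgr_to_ge (@cvg_erf R)); near=> y.
have xy : x <= y by near: y; apply: nbhs_pinfty_ge; rewrite num_real.
have [c _ cE] := mean_value x y (@is_derive_erf R).
rewrite -subr_ge0 cE mulr_ge0 ?subr_ge0// mulr_ge0 ?expR_ge0//.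
Unshelve. all: by end_near. Qed.

(* theta^+ as a function of t = F^+. *)
Definition theta_fun t : R := beta + (1 - beta) * (1 - erf (t / Num.sqrt 2)) / 2.

(* The limit of min_lambda |nu h + 1 - lambda|^2 / (n nu^2) for t = 1 / nu; it
   equals D^+ - 2 t C^+ + t^2 theta^+. *)
Definition psi t : R := beta * (1 + t ^+ 2) + (1 - beta) * tail2 t.

Definition dpsi t : R := 2 * (t * theta_fun t - (1 - beta) * gdens t).

Lemma psiE t : psi t = theta_fun t * (1 + t ^+ 2) - t * ((1 - beta) * gdens t).
Proof. by rewrite /psi /theta_fun /tail2; field. Qed.

Lemma theta_fun_ge t : beta <= theta_fun t.
Proof.
have [b0 b1] := andP beta01.
have := erf_le1 (t / Num.sqrt 2); rewrite /theta_fun => e1.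
by rewrite lerDl divr_ge0// mulr_ge0//; lra.
Qed.

Lemma is_derive_theta_fun t :
  is_derive t 1 theta_fun (- (1 - beta) * gdens t).
Proof.
have h := is_derive1_sub (is_derive1_const 1 t) (is_derive_erf_sqrt2 t).
have := is_derive1_add (is_derive1_const beta t)
  (is_derive1_mulr ((1 - beta) / 2) h).
have -> : (fun z => beta + (1 - beta) / 2 * (1 - erf (z / Num.sqrt 2))) = theta_fun.
  by apply/funext => z; rewrite /theta_fun; field.
by move/is_derive1_eq; apply; field.
Qed.

Lemma is_derive_psi t : is_derive t 1 psi (dpsi t).
Proof.
have h1 := is_derive1_mul (is_derive_theta_fun t)
  (is_derive1_add (is_derive1_const 1 t) (is_derive1_sqr t)).
have h2 := is_derive1_mul (is_derive_id t 1)
  (is_derive1_mulr (1 - beta) (is_derive_gdens t)).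
have := is_derive1_sub h1 h2.
have -> : (fun z => theta_fun z * (1 + z ^+ 2) - id z * ((1 - beta) * gdens z)) = psi.
  by apply/funext => z; rewrite psiE.
by move/is_derive1_eq; apply; rewrite /dpsi /=; ring.
Qed.

Lemma is_derive_dpsi t : is_derive t 1 dpsi (2 * theta_fun t).
Proof.
have h1 := is_derive1_mul (is_derive_id t 1) (is_derive_theta_fun t).
have := is_derive1_mulr 2 (is_derive1_sub h1
  (is_derive1_mulr (1 - beta) (is_derive_gdens t))).
by move/is_derive1_eq; apply; rewrite /=; ring.
Qed.

Lemma continuous_psi : continuous psi.
Proof.
by move=> y; apply: differentiable_continuous; apply/derivable1_diffP;
  case: (is_derive_psi y).
Qed.

(** The second derivative of [psi] is [2 * theta_fun], hence at least [2 * beta]. Two applications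
    of the mean value theorem, to [k] and then to [dpsi], replace Taylor's formula. *)
Lemma psi_strongly_convex t s :
  psi s + dpsi s * (t - s) + beta * (t - s) ^+ 2 <= psi t.
Proof.
pose k u := psi u - (dpsi s * (u - s) + beta * (u - s) ^+ 2).
have dk (u : R) : is_derive u 1 k (dpsi u - (dpsi s + 2 * beta * (u - s))).
  have hs := is_derive1_sub (is_derive_id u 1) (is_derive1_const s u).
  have h2 := is_derive1_mulr beta (@is_derive1_chain _ (fun z => z ^+ 2) (fun z => z - s) u _ _
    (is_derive1_sqr (u - s)) hs).
  have := is_derive1_sub (is_derive_psi u)
    (is_derive1_add (is_derive1_mulr (dpsi s) hs) h2).
  by move/is_derive1_eq; apply; rewrite /=; ring.
have [u us kE] := mean_value s t dk.
have [c cs dE] := mean_value s u is_derive_dpsi.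
have th := theta_fun_ge c.
have H : 0 <= (theta_fun c - beta) * ((u - s) * (t - s)).
  apply: mulr_ge0; first by rewrite subr_ge0.
  have -> : (u - s) * (t - s) = (u - s) * (t - u) + (u - s) ^+ 2 by ring.
  by rewrite addr_ge0// sqr_ge0.
have ks : k s = psi s by rewrite /k; ring.
have dE2 : dpsi u = dpsi s + 2 * theta_fun c * (u - s) by lra.
have : k t - k s = 2 * ((theta_fun c - beta) * ((u - s) * (t - s))).
  by rewrite kE dE2; ring.
rewrite ks /k; lra.
Qed.

Lemma psi0 : psi 0 = theta_fun 0.
Proof. by rewrite psiE; ring. Qed.

(* The right-hand side is D^+ at t = F^+. *)
Lemma psi0_le_Dp t : t <= 0 ->
  psi 0 <= theta_fun t + t * ((1 - beta) * gdens t).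
Proof.
move=> t0; have [b0 b1] := andP beta01.
pose f u := theta_fun u + u * ((1 - beta) * gdens u).
have df (u : R) : is_derive u 1 f (- (1 - beta) * u ^+ 2 * gdens u).
  have h2 := is_derive1_mul (is_derive_id u 1)
    (is_derive1_mulr (1 - beta) (is_derive_gdens u)).
  have := is_derive1_add (is_derive_theta_fun u) h2.
  by move/is_derive1_eq; apply; rewrite /=; ring.
have [c _ cE] := mean_value 0 t df.
have : 0 <= f t - f 0.
  rewrite cE subr0 -mulrA mulNr mulNr -mulrN.
  have h := gdens_gt0 c.
  apply: mulr_ge0; last lra.
  apply: mulr_ge0; [lra|exact: mulr_ge0 (sqr_ge0 _) (ltW h)].
rewrite psi0 /f; lra.
Qed.

(** * A critical point of the limit program is a strict optimum *)

Section Optimum.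
Context (alpha s th : R).
Hypotheses (s_gt0 : 0 < s) (th_gt0 : 0 < th) (below : theta_fun th < alpha)
  (critical : alpha - psi th = (s * (alpha - theta_fun th)) ^+ 2).

Lemma critical_sqrt : Num.sqrt (alpha - psi th) = s * (alpha - theta_fun th).
Proof. by rewrite critical sqrtr_sqr ger0_norm// mulr_ge0 ?ltW// subr_gt0. Qed.

(* The square root of a strongly concave function lies below its tangent. *)
Lemma strict_optimum t : t != th -> psi t <= alpha ->
  s * Num.sqrt (alpha - psi t)
  < 1 + t / th * (s * Num.sqrt (alpha - psi th) - 1).
Proof.
move=> tth pta; have [b0 b1] := andP beta01.
rewrite critical_sqrt; have crit := critical.
set K := s * (alpha - theta_fun th) in crit *.
have K0 : 0 < K by rewrite mulr_gt0// subr_gt0.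
set y := Num.sqrt _; have y0 : 0 <= y by exact: sqrtr_ge0.
have yE : y ^+ 2 = alpha - psi t by rewrite sqr_sqrtr// subr_ge0.
have conv := psi_strongly_convex t th.
have d0 : 0 < beta * (t - th) ^+ 2.
  by rewrite mulr_gt0// exprn_even_gt0//= subr_eq0.
(* The tangent at [th] of the square root is [K - q], with [q] equal to
   [dpsi th * (t - th) / (2 * K)]. Criticality gives [q] this form, which says that [s] times the
   tangent takes the value 1 at [t = 0]. *)
set q := (1 - s * K) / (s * th) * (t - th).
have qE : dpsi th * (t - th) = 2 * K * q.
  rewrite mulrA; congr (_ * _).
  have h1 : alpha - psi th = K ^+ 2 := crit.
  have h2 : alpha = K / s + theta_fun th.
    by rewrite /K mulrC mulKf ?gt_eqF// subrK.
  have h3 := psiE th.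
  have h4 : th * ((1 - beta) * gdens th) =
     K ^+ 2 - K / s + theta_fun th * th ^+ 2 by lra.
  rewrite /dpsi.
  have -> : (1 - beta) * gdens th = (K ^+ 2 - K / s + theta_fun th * th ^+ 2) / th.
    by rewrite -h4; field; rewrite gt_eqF.
  by field; rewrite !gt_eqF.
have yq : y ^+ 2 < K ^+ 2 - 2 * K * q by rewrite yE -qE -crit; lra.
have qK : q < K by nra.
have yK : y < K - q by nra.
have -> : 1 + t / th * (s * K - 1) = s * (K - q).
  by rewrite /q; field; rewrite !gt_eqF.
by rewrite ltr_pM2l.
Qed.

End Optimum.

(** The dummy value of [erfinv] is 0, so a nonzero value is a genuine inverse. *)
Lemma erfinv_neq0 (x : R) : erfinv x != 0 -> erf (erfinv x) = x.
Proof.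
rewrite /erfinv; case: xgetP => [y -> //|]; by rewrite eqxx.
Qed.

Lemma FpE theta : erfinv_arg beta theta = Fp beta theta / Num.sqrt 2.
Proof. by rewrite /Fp mulrC mulKf// gt_eqF ?sqrtr_gt0. Qed.

Lemma theta_funE theta : Fp beta theta != 0 -> theta_fun (Fp beta theta) = theta.
Proof.
have [b0 b1] := andP beta01.
move=> t0; have := t0; rewrite /Fp mulf_eq0 negb_or => /andP[_ /erfinv_neq0 e].
rewrite /theta_fun -FpE /erfinv_arg e; field.
by rewrite subr_eq0 gt_eqF.
Qed.

Lemma CpE theta : Cp beta theta = (1 - beta) * gdens (Fp beta theta).
Proof. by rewrite /Cp gdens_sqrt_pi -FpE mulrA. Qed.

Lemma DpE theta : Dp beta theta = Fp beta theta * Cp beta theta + theta.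
Proof.
rewrite CpE gdens_sqrt_pi -FpE /Dp /Fp div1r sqrtrV ?mulr_ge0 ?pi_ge0// expRN.
by congr (_ + _); ring.
Qed.

Lemma res_limE theta nu : Fp beta theta * nu = 1 ->
  res_lim beta theta nu = nu ^+ 2 * psi (Fp beta theta).
Proof.
move=> tnu; have t0 : Fp beta theta != 0.
  by apply: contra_eq_neq tnu => ->; rewrite mul0r eq_sym oner_neq0.
rewrite /res_lim psiE theta_funE// DpE CpE; set t := Fp beta theta in tnu *.
set C := (1 - beta) * gdens t.
have -> : nu ^+ 2 * (theta * (1 + t ^+ 2) - t * C) =
  nu ^+ 2 * theta + (t * nu) ^+ 2 * theta - nu * (t * nu) * C by ring.
rewrite tnu.
have -> : nu ^+ 2 * (t * C + theta) - 2 * nu * C + theta =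
  nu * (t * nu) * C + nu ^+ 2 * theta - 2 * nu * C + theta by ring.
by rewrite tnu; ring.
Qed.

(** The equation for [alpha_w] reads [t * alpha_w = C] at [t = Fp beta alpha_w], that is
    [dpsi t = 0]. Then [theta * (1 + t ^+ 2) - t * C] collapses to [theta = alpha_w]. *)
Lemma psi_threshold alpha_w : signed_l1_threshold beta alpha_w ->
  exists t, psi t = alpha_w.
Proof.
have [b0 b1] := andP beta01.
case=> /andP[baw aw1]; set x := erfinv_arg beta alpha_w => eq0.
have C0 : 0 < Cp beta alpha_w.
  by rewrite CpE mulr_gt0 ?gdens_gt0// subr_gt0.
have tC : Fp beta alpha_w = Cp beta alpha_w / alpha_w.
  by rewrite /Fp /Cp -/x; move: eq0; rewrite !mulrA; lra.
have a0 : 0 < alpha_w by lra.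
have t0 : Fp beta alpha_w != 0 by rewrite tC gt_eqF// divr_gt0.
exists (Fp beta alpha_w).
rewrite psiE theta_funE// -CpE.
by rewrite tC; field; rewrite gt_eqF.
Qed.

(* The root selected in nu_lim is spurious exactly when nu_lim < 0, in which case
   the limiting objective has positive slope at infinity. *)
Lemma theta_hat_cases alpha alpha_w sigma rsc theta :
  0 < sigma -> 0 < rsc ->
  signed_l1_threshold beta alpha_w -> alpha_w < alpha ->
  is_theta_hat alpha beta sigma rsc theta ->
  let t := Fp beta theta in
  let nu := nu_lim alpha beta sigma rsc theta in
  [/\ t * nu = 1, theta_fun t = theta &
   (t < 0 /\ rsc ^+ 2 < sigma ^+ 2 * (alpha - psi 0)) \/
   [/\ 0 < t, theta < alpha &
     alpha - psi t = (sigma / rsc * (alpha - theta)) ^+ 2]].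
Proof.
move=> sigma0 rsc0 thr below [_ discr0 tnu] t nu.
have t0 : t != 0.
  by apply: contra_eq_neq tnu; rewrite -/t => ->; rewrite mul0r eq_sym oner_neq0.
have thE : theta_fun t = theta by exact: theta_funE.
split=> //.
have [b0 b1] := andP beta01.
pose C := Cp beta theta; pose D := Dp beta theta.
have C0 : 0 < C by rewrite /C CpE mulr_gt0 ?gdens_gt0// subr_gt0.
have DE : D = t * C + theta by exact: DpE.
have pE : psi t = theta * (1 + t ^+ 2) - t * C by rewrite psiE thE /C CpE.
pose s := sigma / rsc; have s0 : 0 < s by rewrite divr_gt0.
pose A := Ap alpha beta sigma rsc theta; pose B := Bp beta sigma rsc theta.
have AE : A = s * (alpha - D) by rewrite /A /Ap /s -/D; ring.
have BE : B = s * C by rewrite /B /Bp /s -/C; ring.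
pose a := A ^+ 2 - alpha + D; pose b := A * B - C; pose c := B ^+ 2 + theta.
(* [k] is the common factor of the leading coefficient [a] and the half linear coefficient [b] of
   the quadratic in [nu]; its sign decides between the cases below. *)
pose k := s ^+ 2 * (alpha - D) - 1.
have aE : a = (alpha - D) * k by rewrite /a /k AE; ring.
have bE : b = C * k by rewrite /b /k AE BE; ring.
have dE : discr alpha beta sigma rsc theta = b ^+ 2 - c * a.
  by [].
have nuE : nu = (- b - Num.sqrt (b ^+ 2 - c * a)) / a by rewrite -dE.
have nu0 : nu != 0.
  by apply: contra_eq_neq tnu; rewrite -/nu => ->; rewrite mulr0 eq_sym oner_neq0.
(* Division by 0 would give [nu = 0], against [t * nu = 1]. *)
have a0 : a != 0 by apply: contra_neq nu0; rewrite nuE => ->; rewrite invr0 mulr0.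
have k0 : k != 0 by apply: contra_neq a0; rewrite aE => ->; rewrite mulr0.
have root1 : a * nu + b = - Num.sqrt (b ^+ 2 - c * a).
  by rewrite nuE mulrC divfK//; ring.
(* The choice of the root is retained only through this sign; [quad] forgets it. *)
have root1_le0 : a * nu + b <= 0 by rewrite root1 oppr_le0 sqrtr_ge0.
have quad : a * nu ^+ 2 + 2 * b * nu + c = 0.
  have : (a * nu + b) ^+ 2 = b ^+ 2 - c * a.
    by rewrite root1 sqrrN sqr_sqrtr -?dE.
  move=> h; apply: (mulfI a0); rewrite mulr0.
  have -> : a * (a * nu ^+ 2 + 2 * b * nu + c) = (a * nu + b) ^+ 2 - (b ^+ 2 - c * a) by ring.
  by rewrite h subrr.
have quadt : a + 2 * b * t + c * t ^+ 2 = 0.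
  have -> : a + 2 * b * t + c * t ^+ 2 =
    (t * nu) ^+ 2 * a + 2 * b * t * (t * nu) + c * t ^+ 2 by rewrite tnu; ring.
  have -> : (t * nu) ^+ 2 * a + 2 * b * t * (t * nu) + c * t ^+ 2 =
    t ^+ 2 * (a * nu ^+ 2 + 2 * b * nu + c) by ring.
  by rewrite quad mulr0.
(* In terms of [t = 1 / nu] the quadratic is [(A + B * t) ^+ 2 = alpha - psi t], and
   [A + B * t = s * (alpha - theta)]. *)
have crit : alpha - psi t = (s * (alpha - theta)) ^+ 2.
  have : (A + B * t) ^+ 2 = alpha - psi t.
    move: quadt; rewrite /a /b /c pE DE; lra.
  by rewrite AE BE DE => <-; congr (_ ^+ 2); ring.
have kth : k * (nu * (alpha - theta)) <= 0.
  have -> : k * (nu * (alpha - theta)) = k * ((alpha - D) * nu + C * (t * nu)).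
    by rewrite DE; ring.
  by move: root1_le0; rewrite tnu aE bE; lra.
have c0 : 0 < c.
  by rewrite /c ltr_wpDl ?sqr_ge0// -thE; apply: lt_le_trans (theta_fun_ge _).
have ct0 : 0 < c * t ^+ 2 by rewrite mulr_gt0// exprn_even_gt0.
have kq : k * (alpha - D + 2 * C * t) = - (c * t ^+ 2).
  by move: quadt; rewrite aE bE; lra.
have nut : nu = t^-1 by apply: (mulfI t0); rewrite divff.
have [tpos|tneg] : 0 < t \/ t < 0 by apply/orP; rewrite -neq_lt eq_sym.
- right; have nupos : 0 < nu by rewrite nut invr_gt0.
  (* If [alpha < theta], the sign [kth] forces [k > 0], hence [alpha > D = t * C + theta], which is
     absurd for positive [t]. *)
  have le_th : theta <= alpha.
    rewrite leNgt; apply/negP => h.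
    have k1 : 0 < k.
      rewrite lt_def k0/=; rewrite leNgt; apply/negP => kneg.
      have h1 : nu * (alpha - theta) < 0 by rewrite pmulr_rlt0// subr_lt0.
      have : 0 < k * (nu * (alpha - theta)) by rewrite nmulr_rgt0.
      lra.
    have aD : 0 < alpha - D.
      have : 0 < s ^+ 2 * (alpha - D) by rewrite /k in k1; lra.
      by rewrite pmulr_rgt0// exprn_gt0.
    have : 0 < t * C by rewrite mulr_gt0.
    by rewrite DE in aD; lra.
  split=> //; rewrite lt_neqAle le_th andbT; apply/negP => /eqP th_al.
  (* If [theta = alpha], then [psi t = alpha] and [dpsi t = 0], so [alpha] would be the minimum of
     [psi]; but [psi] takes the smaller value [alpha_w]. *)
  have [u uE] := psi_threshold thr.
  have pa : psi t = alpha by move: crit; rewrite th_al subrr mulr0 expr0n/=; lra.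
  have d0 : dpsi t = 0.
    have h : t * (t * theta - C) = 0 by move: pE; rewrite pa -th_al; lra.
    rewrite /dpsi thE -[(1 - beta) * _]CpE -/C.
    by move/eqP: h; rewrite mulf_eq0 (negbTE t0)/= => /eqP->; rewrite mulr0.
  have := psi_strongly_convex u t; rewrite uE d0 mul0r addr0 pa.
  have : 0 <= beta * (u - t) ^+ 2 by rewrite mulr_ge0 ?sqr_ge0// ltW.
  lra.
- left; split=> //.
  have nuneg : nu < 0 by rewrite nut invr_lt0.
  have tC : t * C < 0 by rewrite nmulr_rlt0.
  (* If [k < 0], then [kq] gives [theta < alpha], and [kth] fails because [nu] is negative. With
     [k > 0], the bound [psi 0 <= D] yields the slope condition. *)
  have k1 : 0 < k.
    rewrite lt_def k0/= leNgt; apply/negP => kneg.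
    have h1 : 0 < alpha - D + 2 * C * t.
      by rewrite -(nmulr_rlt0 _ kneg) kq oppr_lt0.
    have h2 : 0 < alpha - theta by move: h1; rewrite DE; lra.
    have : 0 < k * (nu * (alpha - theta)) by rewrite nmulr_rgt0// nmulr_rlt0.
    lra.
  have := psi0_le_Dp (ltW tneg); rewrite thE -[(1 - beta) * _]CpE -/C addrC -DE => pD.
  have : 1 < s ^+ 2 * (alpha - psi 0).
    have : s ^+ 2 * (alpha - D) <= s ^+ 2 * (alpha - psi 0).
      by rewrite ler_wpM2l ?sqr_ge0//; lra.
    by rewrite /k in k1; lra.
  by rewrite /s expr_div_n mulrAC ltr_pdivlMr ?exprn_gt0// mul1r.
Qed.

End LimitFunction.

(** * The program in finite dimension *)

Section FiniteProgram.
Context (R : realType) (m n k : nat).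
Variables (sigma r : R) (g : 'cV[R]_m) (h : 'cV[R]_n).
Hypotheses (sigma_gt0 : 0 < sigma).
Implicit Types (t x y a e nu : R) (lam : 'cV[R]_n) (p : R * 'cV[R]_n).

(* min_l (nu x + 1 - l)^2 / nu^2 for t = 1 / nu, over l >= 0 if free, and over
   l = 0 otherwise. *)
Definition coord_resid (free : bool) (t x : R) : R :=
  if free then Num.min (x + t) 0 ^+ 2 else (x + t) ^+ 2.

Definition min_resid t : R := \sum_(i < n) coord_resid (i < n - k)%N t (h i 0).

Definition best_lam nu : 'cV[R]_n :=
  \col_i if (i < n - k)%N then Num.max (nu * h i 0 + 1) 0 else 0.

Lemma l2normE q (x : 'cV[R]_q) : l2norm x ^+ 2 = \sum_i x i 0 ^+ 2.
Proof. by rewrite sqr_sqrtr// sumr_ge0// => i _; exact: sqr_ge0. Qed.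

Lemma coord_resid_scale free nu x : 0 < nu ->
  nu ^+ 2 * coord_resid free nu^-1 x =
  if free then Num.min (nu * x + 1) 0 ^+ 2 else (nu * x + 1) ^+ 2.
Proof.
move=> nu0; have E : nu * (x + nu^-1) = nu * x + 1.
  by rewrite mulrDr divff ?gt_eqF.
rewrite /coord_resid; case: free; rewrite -exprMn; last by rewrite E.
by rewrite minr_pMr ?ltW// E mulr0.
Qed.

Lemma min_resid_le nu lam : 0 < nu ->
  (forall i : 'I_n, (n - k <= i)%N -> lam i 0 = 0) ->
  (forall i : 'I_n, (i < n - k)%N -> 0 <= lam i 0) ->
  nu ^+ 2 * min_resid nu^-1 <= l2norm (residual h nu lam) ^+ 2.
Proof.
move=> nu0 lam0 lam_ge0; rewrite l2normE mulr_sumr; apply: ler_sum => i _.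
rewrite coord_resid_scale// !mxE; case: ifPn => [ik|]; last first.
  by rewrite -leqNgt => /lam0 ->; rewrite subr0.
have := lam_ge0 i ik; set l := lam i 0; set u := nu * h i 0 + 1 => l0.
by have [u0|u0] := leP u 0; [nra|rewrite expr0n sqr_ge0].
Qed.

Lemma best_lam_resid nu : 0 < nu ->
  l2norm (residual h nu (best_lam nu)) ^+ 2 = nu ^+ 2 * min_resid nu^-1.
Proof.
move=> nu0; rewrite l2normE mulr_sumr; apply: eq_bigr => i _.
rewrite coord_resid_scale// !mxE; case: ifPn => [ik|_]; last by rewrite subr0.
set u := nu * h i 0 + 1.
by have [u0|u0] := leP u 0; rewrite ?subr0// subrr.
Qed.

Definition gamma : R := l2norm g ^+ 2.

Lemma radicand_le p : gen_feasible k g h p -> 0 < p.1 ->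
  radicand g h p.1 p.2 <= p.1 ^+ 2 * (gamma - min_resid p.1^-1).
Proof.
case=> _ lam0 lam_ge0 _ nu0; rewrite /radicand.
have := min_resid_le nu0 lam0 lam_ge0; rewrite /gamma; lra.
Qed.

Lemma min_resid_le_gamma p : gen_feasible k g h p -> 0 < p.1 ->
  min_resid p.1^-1 <= gamma.
Proof.
move=> pf p0; have := radicand_le pf p0; have [_ _ _ r0] := pf.
move=> /(le_trans r0); rewrite pmulr_rge0 ?exprn_gt0//; lra.
Qed.

Definition best_point t : R * 'cV[R]_n := (t^-1, best_lam t^-1).

Lemma best_point_radicand t : 0 < t ->
  radicand g h t^-1 (best_lam t^-1) = t^-1 ^+ 2 * (gamma - min_resid t).
Proof.
move=> t0; rewrite /radicand best_lam_resid ?invr_gt0// invrK /gamma; ring.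
Qed.

Lemma best_point_feasible t : 0 < t -> min_resid t <= gamma ->
  gen_feasible k g h (best_point t).
Proof.
move=> t0 tg; split => /=.
- by rewrite invr_ge0 ltW.
- by move=> i ik; rewrite mxE ltnNge ik.
- by move=> i ik; rewrite mxE ik le_max lexx orbT.
- by rewrite best_point_radicand// mulr_ge0 ?sqr_ge0// subr_ge0.
Qed.

(* The objective, maximized over lambda, is margin t / t at nu = 1 / t. *)
Definition margin t : R := sigma * Num.sqrt (gamma - min_resid t) - r.

Lemma best_point_obj t : 0 < t -> gen_obj sigma r g h (best_point t) = margin t / t.
Proof.
move=> t0; rewrite /gen_obj /= best_point_radicand// sqrtrM ?sqr_ge0//.
by rewrite sqrtr_sqr gtr0_norm ?invr_gt0// /margin; ring.
Qed.

Lemma gen_obj_le p : gen_feasible k g h p -> 0 < p.1 ->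
  gen_obj sigma r g h p <= margin p.1^-1 / p.1^-1.
Proof.
move=> pf p0; rewrite /gen_obj /margin invrK.
have : Num.sqrt (radicand g h p.1 p.2) <=
    p.1 * Num.sqrt (gamma - min_resid p.1^-1).
  have -> : p.1 * Num.sqrt (gamma - min_resid p.1^-1) =
      Num.sqrt (p.1 ^+ 2 * (gamma - min_resid p.1^-1)).
    by rewrite sqrtrM ?sqr_ge0// sqrtr_sqr gtr0_norm.
  by rewrite ler_wsqrtr// radicand_le.
by rewrite -(ler_pM2l sigma_gt0); lra.
Qed.

(** At [nu = 0] the residual equals 1 on the coordinate [n - k], the first one with multiplier 0,
    and the radicand is negative. This is what permits the substitution [t = 1 / nu]. *)
Lemma gen_feasible_gt0 p : (0 < k <= n)%N -> gen_feasible k g h p -> 0 < p.1.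
Proof.
move=> /andP[k0 kn] [p0 lam0 _ rad0]; rewrite lt_def p0 andbT; apply/eqP => p1.
have ik : (n - k < n)%N by rewrite ltn_subrL k0 (leq_trans k0 kn).
pose i := Ordinal ik.
move: rad0; rewrite /radicand p1 expr0n mulr0 sub0r oppr_ge0 l2normE.
rewrite (bigD1 i)//= !mxE mul0r add0r (lam0 i)// subr0 expr1n.
have : 0 <= \sum_(j < n | j != i) residual h 0 p.2 j 0 ^+ 2.
  by apply: sumr_ge0 => j _; exact: sqr_ge0.
lra.
Qed.

(** The minimum with 0 is concave, and squaring is convex and decreasing on nonpositive numbers. *)
Lemma coord_resid_convex free a x y z : 0 <= a <= 1 ->
  coord_resid free (a * x + (1 - a) * y) z <=
  a * coord_resid free x z + (1 - a) * coord_resid free y z.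
Proof.
move=> /andP[a0 a1]; have a1' : 0 <= 1 - a by lra.
have sq (u v : R) : (a * u + (1 - a) * v) ^+ 2 <= a * u ^+ 2 + (1 - a) * v ^+ 2.
  have -> : a * u ^+ 2 + (1 - a) * v ^+ 2 =
    (a * u + (1 - a) * v) ^+ 2 + a * (1 - a) * (u - v) ^+ 2 by ring.
  by rewrite lerDl; apply: mulr_ge0; [exact: mulr_ge0|exact: sqr_ge0].
rewrite /coord_resid; case: free; last first.
  by apply: le_trans (sq _ _); rewrite le_eqVlt; apply/orP; left; apply/eqP; ring.
apply: le_trans (sq _ _).
set u := Num.min (z + x) 0; set v := Num.min (z + y) 0.
have [ux u0] : u <= z + x /\ u <= 0 by apply/andP; rewrite -le_min.
have [vy v0] : v <= z + y /\ v <= 0 by apply/andP; rewrite -le_min.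
have aux : a * u <= a * (z + x) by rewrite ler_wpM2l.
have auy : (1 - a) * v <= (1 - a) * (z + y) by rewrite ler_wpM2l.
have au0 : a * u <= 0 by rewrite mulr_ge0_le0.
have av0 : (1 - a) * v <= 0 by rewrite mulr_ge0_le0.
set w := Num.min _ 0.
have w0 : w <= 0 by rewrite ge_min lexx orbT.
have wuv : a * u + (1 - a) * v <= w by rewrite le_min; apply/andP; split; lra.
by rewrite -[leLHS]sqrrN -[leRHS]sqrrN lerXn2r ?nnegrE; lra.
Qed.

Lemma min_resid_convex a x y : 0 <= a <= 1 ->
  min_resid (a * x + (1 - a) * y) <= a * min_resid x + (1 - a) * min_resid y.
Proof.
move=> a01; rewrite /min_resid !mulr_sumr -big_split/=.
by apply: ler_sum => i _; exact: coord_resid_convex.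
Qed.

Lemma convex_weight x y t : x <= t <= y -> x < y ->
  exists2 a, 0 <= a <= 1 & t = a * x + (1 - a) * y.
Proof.
move=> /andP[xt ty] xy; have xy0 : 0 < y - x by rewrite subr_gt0.
exists ((y - t) / (y - x)); last by field; rewrite gt_eqF.
by apply/andP; split; [apply: divr_ge0; lra|rewrite ler_pdivrMr//; lra].
Qed.

Lemma min_resid_between x y t M : x <= t <= y ->
  min_resid x <= M -> min_resid y <= M -> min_resid t <= M.
Proof.
move=> /andP[xt ty] xM yM; have [xy|xy] := ltP x y; last first.
  by have -> : t = x by apply/eqP; rewrite eq_le xt (le_trans ty xy).
have [a /andP[a0 a1] ->] := @convex_weight x y t (introT andP (conj xt ty)) xy.
apply: le_trans (min_resid_convex _ _ _) _; first by rewrite a0.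
have h1 : a * min_resid x <= a * M by rewrite ler_wpM2l.
have h2 : (1 - a) * min_resid y <= (1 - a) * M by rewrite ler_wpM2l//; lra.
lra.
Qed.

(** Feasibility at both ends is essential: [Num.sqrt] is 0 on negative numbers, and concavity is
    lost across the boundary of the feasible interval. *)
Lemma margin_concave a x y : 0 <= a <= 1 ->
  min_resid x <= gamma -> min_resid y <= gamma ->
  a * margin x + (1 - a) * margin y <= margin (a * x + (1 - a) * y).
Proof.
move=> a01 xg yg; have /andP[a0 a1] := a01; rewrite /margin.
have conv := min_resid_convex x y a01.
set u := Num.sqrt (gamma - min_resid x); set v := Num.sqrt (gamma - min_resid y).
have u2 : u ^+ 2 = gamma - min_resid x by rewrite sqr_sqrtr// subr_ge0.
have v2 : v ^+ 2 = gamma - min_resid y by rewrite sqr_sqrtr// subr_ge0.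
have u0 : 0 <= u by exact: sqrtr_ge0.
have v0 : 0 <= v by exact: sqrtr_ge0.
have uv0 : 0 <= a * u + (1 - a) * v by rewrite addr_ge0// mulr_ge0//; lra.
have : a * u + (1 - a) * v <= Num.sqrt (gamma - min_resid (a * x + (1 - a) * y)).
  rewrite -(ger0_norm uv0) -sqrtr_sqr ler_wsqrtr//.
  have -> : (a * u + (1 - a) * v) ^+ 2 =
    a * u ^+ 2 + (1 - a) * v ^+ 2 - a * (1 - a) * (u - v) ^+ 2 by ring.
  have : 0 <= a * (1 - a) * (u - v) ^+ 2.
    by apply: mulr_ge0; [apply: mulr_ge0; lra|exact: sqr_ge0].
  by rewrite u2 v2; lra.
rewrite -(ler_pM2l sigma_gt0); lra.
Qed.

Lemma continuous_min_resid : continuous min_resid.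
Proof.
have cc free z : continuous (fun t => coord_resid free t z).
  move=> t; rewrite /coord_resid; case: free.
    apply: (@continuous_comp _ _ _ (fun t => Num.min (z + t) 0) (fun z => z ^+ 2)).
      apply: continuous_min; last exact: cvg_cst.
      by apply: cvgD; [exact: cvg_cst|exact: cvg_id].
    exact: exprn_continuous.
  apply: (@continuous_comp _ _ _ (fun t => z + t) (fun z => z ^+ 2)).
    by apply: cvgD; [exact: cvg_cst|exact: cvg_id].
  exact: exprn_continuous.
rewrite /min_resid; elim: (index_enum _) => [|i s IH] t.
  by under eq_fun do rewrite big_nil; exact: cvg_cst.
under eq_fun do rewrite big_cons.
by apply: cvgD; [exact: cc|exact: IH].
Qed.

(** * Trapping the maximizer between two test points *)

Section Localization.
Variables (th e : R).
Hypotheses (e_gt0 : 0 < e) (e_th : e < th)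
  (feas : min_resid th <= gamma) (feasl : min_resid (th - e) <= gamma)
  (feasr : min_resid (th + e) <= gamma)
  (ml : margin (th - e) < margin th / th * (th - e))
  (mr : margin (th + e) < margin th / th * (th + e)).

Let th_gt0 : 0 < th. Proof. exact: lt_trans e_th. Qed.

(* margin is concave, and margin - c id with c = margin th / th vanishes at th
   and is negative at th - e and th + e. *)
Lemma localize t : 0 < t -> min_resid t <= gamma ->
  margin th / th <= margin t / t -> `|t - th| <= e.
Proof.
move=> t0 tg; set c := margin th / th; rewrite ler_pdivlMr// => ct.
have cth : c * th = margin th by rewrite /c divfK ?gt_eqF.
have e0 := e_gt0; have h3 a : a * (c * th) = a * margin th by rewrite cth.
rewrite leNgt; apply/negP; rewrite ltr_normr => /orP[h1|h1].
- have c1 : th <= th + e <= t by apply/andP; split; lra.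
  have c2 : th < t by lra.
  have [a a01 aE] := convex_weight c1 c2.
  have := margin_concave a01 feas tg; rewrite -aE => cc.
  have /andP[a0 a1] := a01.
  have h2 : (1 - a) * (c * t) <= (1 - a) * margin t by rewrite ler_wpM2l//; lra.
  have := h3 a; move: mr; rewrite -/c [in ltRHS]aE; lra.
- have c1 : t <= th - e <= th by apply/andP; split; lra.
  have c2 : t < th by lra.
  have [a a01 aE] := convex_weight c1 c2.
  have := margin_concave a01 tg feas; rewrite -aE => cc.
  have /andP[a0 a1] := a01.
  have h2 : a * (c * t) <= a * margin t by rewrite ler_wpM2l.
  have := h3 (1 - a); move: ml; rewrite -/c [in ltRHS]aE; lra.
Qed.

(** The set of feasible [t] need not be compact, so the maximum is taken over the segment around
    [th]; by [localize], points outside it do worse than [th]. *)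
Lemma gen_solution_exists : (0 < k <= n)%N ->
  exists p, is_gen_solution k sigma r g h p.
Proof.
move=> kn; have e0 := e_gt0; have eth := e_th.
have le_ends : th - e <= th + e by lra.
have cf : {within `[th - e, th + e], continuous (fun t => margin t / t)}.
  apply: continuous_in_subspaceT => t; rewrite inE/= in_itv/= => /andP[tl _].
  apply: cvgM; last by apply: cvgV; [rewrite gt_eqF//; lra|exact: cvg_id].
  apply: cvgB; last exact: cvg_cst.
  apply: cvgMr; apply: continuous_cvg; first exact: sqrt_continuous.
  by apply: cvgB; [exact: cvg_cst|exact: continuous_min_resid].
have [t] := EVT_max le_ends cf; rewrite in_itv/= => /andP[tl tr] tmax.
have t0 : 0 < t by lra.
have tg : min_resid t <= gamma by apply: min_resid_between feasl feasr; rewrite tl.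
exists (best_point t); split; first exact: best_point_feasible.
move=> q qf; have q0 := gen_feasible_gt0 kn qf.
have qg := min_resid_le_gamma qf q0.
rewrite best_point_obj//; apply: le_trans (gen_obj_le qf q0) _.
have thmax : margin th / th <= margin t / t by apply: tmax; rewrite in_itv/=; lra.
have [lt|ge] := ltP (margin q.1^-1 / q.1^-1) (margin th / th).
  exact: le_trans (ltW lt) thmax.
have qi0 : 0 < q.1^-1 by rewrite invr_gt0.
have := localize qi0 qg ge; rewrite ler_norml => /andP[h1 h2].
by apply: tmax; rewrite in_itv/=; lra.
Qed.

(* The lower bound on min_resid t comes from convexity at the midpoint th of t
   and 2 th - t. *)
Lemma gen_solution_near p : (0 < k <= n)%N -> is_gen_solution k sigma r g h p ->
  let t := p.1^-1 in
  [/\ 0 < t, `|t - th| <= e,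
    radicand g h p.1 p.2 = p.1 ^+ 2 * (gamma - min_resid t) &
    `|min_resid t - min_resid th| <=
      Num.max (min_resid (th - e)) (min_resid (th + e)) - min_resid th].
Proof.
move=> kn [pf pmax] t; have e0 := e_gt0; have p0 := gen_feasible_gt0 kn pf.
have t0 : 0 < t by rewrite invr_gt0.
have tg := min_resid_le_gamma pf p0.
have near_t : `|t - th| <= e.
  apply: localize => //; apply: le_trans _ (gen_obj_le pf p0).
  by rewrite -best_point_obj//; apply: pmax; exact: best_point_feasible.
split => //.
  apply/eqP; rewrite eq_le radicand_le//=.
  (* Comparison of the maximizer with the best [lam] for its own [nu] gives the converse of
     [radicand_le]. *)
  have := pmax _ (best_point_feasible t0 tg); rewrite /gen_obj /= best_point_radicand//.
  have [_ _ _ rad0] := pf.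
  rewrite /t invrK lerD2r ler_pM2l// ler_psqrt ?nnegrE//.
  by rewrite mulr_ge0 ?sqr_ge0// subr_ge0.
move: near_t; rewrite ler_norml => /andP[h1 h2].
set M := Num.max _ _.
have Ml : min_resid (th - e) <= M by rewrite le_max lexx.
have Mr : min_resid (th + e) <= M by rewrite le_max lexx orbT.
have up : min_resid t <= M by apply: min_resid_between Ml Mr; lra.
have up2 : min_resid (2 * th - t) <= M by apply: min_resid_between Ml Mr; lra.
have : min_resid th <= 2^-1 * min_resid t + (1 - 2^-1) * min_resid (2 * th - t).
  have -> : min_resid th = min_resid (2^-1 * t + (1 - 2^-1) * (2 * th - t)).
    by congr min_resid; field.
  by apply: min_resid_convex; lra.
by rewrite ler_norml; lra.
Qed.

End Localization.

Lemma xi_gen_solution p : is_gen_solution k sigma r g h p ->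
  xi_gen k sigma r g h = (gen_obj sigma r g h p)%:E.
Proof.
move=> [pf pmax]; apply/eqP; rewrite eq_le; apply/andP; split.
  by apply: ge_ereal_sup => _ [q qf <-]; rewrite lee_fin; exact: pmax.
by apply: ereal_sup_ubound; exists p.
Qed.

Lemma gen_solutionP : (exists p, is_gen_solution k sigma r g h p) ->
  is_gen_solution k sigma r g h (gen_solution k sigma r g h).
Proof.
by case=> p ps; rewrite /gen_solution; case: xgetP => // /(_ p).
Qed.

(** Along the best points the objective is [margin nu^-1 * nu], with [margin] bounded below by [eps]
    on the segment from 0 to [t0]. The term in [xt] vanishes because [best_lam] is 0 on the last [k]
    coordinates. *)
Lemma xi_prim_pinfty (xt : 'cV[R]_n) t0 : 0 < t0 ->
  min_resid 0 < gamma -> min_resid t0 < gamma ->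
  r < sigma * Num.sqrt (gamma - Num.max (min_resid 0) (min_resid t0)) ->
  xi_prim k sigma r g h xt = +oo%E.
Proof.
move=> t00 g0 gt0; set M := Num.max _ _ => rM.
set eps := sigma * Num.sqrt (gamma - M) - r.
have eps0 : 0 < eps by rewrite subr_gt0.
apply/eqyP => x x0; rewrite /xi_prim.
(* The first bound puts [nu^-1] below [t0], the second makes [eps * nu] exceed [x]. *)
pose nu := Num.max t0^-1 (`|x| / eps).
have nu0 : 0 < nu by rewrite lt_max invr_gt0 t00.
have nut : nu^-1 <= t0.
  by rewrite invf_ple ?posrE// le_max lexx.
have rl : min_resid nu^-1 <= M.
  apply: (@min_resid_between 0 t0); rewrite ?le_max ?lexx ?orbT//.
  by rewrite invr_ge0 ltW.
have Mg : M < gamma by rewrite gt_max g0.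
have nui : 0 < nu^-1 by rewrite invr_gt0.
have pf : gen_feasible k g h (best_point nu^-1).
  by apply: best_point_feasible => //; lra.
have [pf0 pfl pfg pfr] := pf.
apply: (@le_trans _ _ (prim_obj k sigma r g h xt (best_point nu^-1))%:E); last first.
  apply: ereal_sup_ubound; exists (best_point nu^-1) => //; split => // i.
  by have [ik|ik] := leqP (n - k) i; [rewrite pfl|exact: pfg].
rewrite /prim_obj big1 ?subr0; last by move=> i ik; rewrite pfl// mul0r.
rewrite -/(gen_obj sigma r g h (best_point nu^-1)) best_point_obj// invrK lee_fin.
have h1 : eps <= margin nu^-1.
  by rewrite /eps /margin lerD2r ler_pM2l// ler_wsqrtr//; lra.
apply: (@le_trans _ _ (eps * nu)); last by rewrite ler_pM2r.
apply: (le_trans (ler_norm x)); rewrite mulrC -ler_pdivrMr//.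
by rewrite le_max lexx orbT.
Qed.

End FiniteProgram.

(** * Concentration and limits *)

Section TruncatedMeans.
Context (R : realType) (d : measure_display) (T : measurableType d)
  (P : probability T R).

(* The integral of a nonmeasurable function is a lower integral of its positive
   part minus one of its negative part, which is still monotone. *)
Lemma le_integral_ptwise (f1 f2 : T -> \bar R) : (forall x, f1 x <= f2 x)%E ->
  (\int[P]_x f1 x <= \int[P]_x f2 x)%E.
Proof.
have ge0_le (u v : T -> \bar R) : (forall x, 0 <= u x)%E -> (forall x, u x <= v x)%E ->
    (\int[P]_x u x <= \int[P]_x v x)%E.
  move=> u0 uv; have v0 x : (0 <= v x)%E := le_trans (u0 x) (uv x).
  rewrite !ge0_integralTE//; apply: ge_ereal_sup => _ [q /= qu <-].
  by apply: ereal_sup_ubound; exists q => // x; exact: le_trans (qu x) (uv x).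
move=> f12; rewrite integralE [leRHS]integralE; apply: leeB.
  apply: ge0_le => x; first exact: funepos_ge0.
  by apply: (funepos_le (D := setT)) => [y _|]; [exact: f12|rewrite inE].
apply: ge0_le => x; first exact: funeneg_ge0.
by apply: (funeneg_le (D := setT)) => [y _|]; [exact: f12|rewrite inE].
Qed.

Lemma integral_cst_indic (a b : R) (E : set T) : measurable E ->
  (\int[P]_x (a + b * \1_E x)%:E = a%:E + b%:E * P E)%E.
Proof.
move=> mE; under eq_integral do rewrite EFinD EFinM.
have I1 : P.-integrable setT (fun x => (\1_E x : R)%:E) by exact: integrable_indic.
rewrite integralD//; last by apply: integrableZl.
  rewrite integralZl// integral_indicT//; congr (_ + _)%E.
  rewrite -[LHS]/(\int[P]_x (cst a%:E x))%E integral_cst//.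
  by rewrite [X in (_ * X)%E](_ : _ = 1%E) ?mule1//; exact: probability_setT.
exact: finite_measure_integrable_cst.
Qed.

Lemma truncated_mean_cvg (n : nat -> nat) (X : nat -> T -> R) (l M : R) :
  n @ \oo --> \oo ->
  (forall e : R, 0 < e -> overwhelming P n (fun j => [set w | `|X j w - l| <= e])) ->
  `|l| < M -> truncated_mean P M (X j) @[j --> \oo] --> l%:E.
Proof.
move=> n_oo conc lM; have M0 : 0 < M := le_lt_trans (normr_ge0 l) lM.
suff near_l e : 0 < e -> \forall j \near \oo,
    ((l - e)%:E <= truncated_mean P M (X j) <= (l + e)%:E)%E.
  have fin : \forall j \near \oo, truncated_mean P M (X j) \is a fin_num.
    apply: filterS (near_l 1 ltr01) => j /andP[h1 h2].
    by rewrite fin_real// (lt_le_trans _ h1) ?ltNyr// (le_lt_trans h2)// ltry.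
  apply/fine_cvgP; split => //; apply/cvgrPdist_le => e e0.
  near=> j.
  have fj : truncated_mean P M (X j) \is a fin_num by near: j.
  have : ((l - e)%:E <= truncated_mean P M (X j) <= (l + e)%:E)%E.
    by near: j; exact: near_l.
  rewrite -(fineK fj) !lee_fin => /andP[h1 h2].
  by rewrite /= ler_norml; apply/andP; split; lra.
(* Within [M - |l|] of [l] the truncation is inactive. Off the event the truncated variable is still
   bounded by [M], so it contributes at most [2 * M] times an exponentially small probability. *)
move=> e0; pose e' := Num.min (e / 2) (M - `|l|).
have e'0 : 0 < e' by rewrite lt_min divr_gt0//= subr_gt0.
have [e'1 e'2] : e' <= e / 2 /\ e' <= M - `|l| by apply/andP; rewrite -le_min.
have [c c0 H] := conc e' e'0.
near=> j.
have [E [mE EX PE]] : exists E : set T, [/\ measurable E,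
    E `<=` [set w | `|X j w - l| <= e'] & ((1 - expR (- c * (n j)%:R))%:E <= P E)%E].
  by near: j.
have PEc := probability_setC_le mE PE.
have nj : (4 * M / e) / c <= (n j)%:R by near: j; exact: near_nat_ge.
have small : 2 * M * expR (- c * (n j)%:R) <= e / 2.
  rewrite mulNr expRN ler_pdivrMr ?expR_gt0//.
  have h1 : 4 * M / e <= expR (c * (n j)%:R).
    apply: le_trans (expR_ge1Dx _).
    by move: nj; rewrite ler_pdivrMr// mulrC; lra.
  by move: h1; rewrite ler_pdivrMr//; lra.
rewrite /truncated_mean unlock.
set Y := fun w => if `|X j w| <= M then X j w else 0.
have mEc : measurable (~` E) by exact: measurableC.
have [q qE] : exists q, P (~` E) = q%:E.
  by exists (fine (P (~` E))); rewrite fineK// fin_num_measure.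
have q0 : 0 <= q by rewrite -lee_fin -qE.
have qsmall : 2 * M * q <= e / 2.
  apply: le_trans small; rewrite ler_wpM2l//; first by rewrite mulr_ge0// ltW.
  by rewrite -lee_fin -qE.
have [lM1 lM2] : - M < l /\ l < M by apply/andP; rewrite -ltr_norml.
have Yb w : l - e' + - (2 * M) * \1_(~` E) w <= Y w
    /\ Y w <= l + e' + 2 * M * \1_(~` E) w.
  rewrite /Y indicE; have [wE|wE] := pselect (E w).
    rewrite memNset ?mulr0 ?addr0; last by move=> /= h; exact: h.
    have := EX w wE; rewrite /= ler_norml => /andP[h1 h2].
    have -> : `|X j w| <= M.
      have := ler_norm l; have := ler_norm (- l); rewrite normrN => h3 h4.
      by rewrite ler_norml; apply/andP; split; lra.
    by split; lra.
  rewrite mem_set// (_ : true%:R = 1 :> R)// !mulr1.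
  by case: ifP => [|_]; [rewrite ler_norml => /andP[h1 h2]|]; split; lra.
apply/andP; split.
  apply: (@le_trans _ _ (\int[P]_w (l - e' + - (2 * M) * \1_(~` E) w)%:E)%E).
    rewrite integral_cst_indic// qE -EFinM -EFinD lee_fin; lra.
  by apply: le_integral_ptwise => w; rewrite lee_fin; case: (Yb w).
apply: (@le_trans _ _ (\int[P]_w (l + e' + 2 * M * \1_(~` E) w)%:E)%E).
  by apply: le_integral_ptwise => w; rewrite lee_fin; case: (Yb w).
rewrite integral_cst_indic// qE -EFinM -EFinD lee_fin; lra.
Unshelve. all: by end_near. Qed.

Lemma concentrating_point_cvg (n : nat -> nat) (n_oo : n @ \oo --> \oo)
    (X : nat -> T -> R) (l : R) :
  (fun p => X p.1 p.2) @ ow P n --> l -> concentrating_point P n X l.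
Proof.
move=> Xl; have FF := ow_filter P n_oo.
have conc e : 0 < e -> overwhelming P n (fun j => [set w | `|X j w - l| <= e]).
  move=> e0; have /cvgrPdist_le /(_ e e0) := Xl.
  move=> h; suff: ow P n [set p | `|X p.1 p.2 - l| <= e] by [].
  by apply: filterS h => p /=; rewrite distrC.
split; first exact: conc.
by move=> M lM; apply: (truncated_mean_cvg n_oo conc lM).
Qed.

End TruncatedMeans.

(** * Limits of the random program along the sequence of problems *)

Section Asymptotics.
Context (R : realType) (d : measure_display) (T : measurableType d)
  (P : probability T R).
Unset Implicit Arguments.
Variables (alpha beta sigma rsc : R) (n m k : nat -> nat) (r : nat -> R).
Variables (g : forall j, 'I_(m j) -> {RV P >-> R})
  (h : forall j, 'I_(n j) -> {RV P >-> R}).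
Hypotheses (alpha01 : 0 < alpha < 1) (beta01 : 0 < beta < 1)
  (n_oo : n @ \oo --> \oo)
  (m_n : (m j)%:R / (n j)%:R @[j --> \oo] --> alpha)
  (k_n : (k j)%:R / (n j)%:R @[j --> \oo] --> beta)
  (sigma_gt0 : 0 < sigma) (rsc_gt0 : 0 < rsc)
  (r_n : r j / Num.sqrt (n j)%:R @[j --> \oo] --> rsc)
  (gh_normal : forall j, indep_normal (fun=> 1) (sum_family (g j) (h j))).

Set Implicit Arguments.

Let F := ow P n.
#[local] Instance FF : Filter F := ow_filter P n_oo.

Let gv (p : nat * T) := random_vector (g p.1) p.2.
Let hv (p : nat * T) := random_vector (h p.1) p.2.
Let N (p : nat * T) : R := (n p.1)%:R.
Let sN (p : nat * T) : R := Num.sqrt (n p.1)%:R.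
Let G p := gamma (gv p).
Let Q t p := min_resid (k p.1) (hv p) t.

Lemma near_ow (S : nat -> Prop) : (\forall j \near \oo, S j) ->
  \forall p \near F, S p.1.
Proof. by move=> H; exact: (@cvg_fst_ow _ _ _ P n _ H). Qed.

Lemma near_N : \forall p \near F, 0 < N p.
Proof.
suff H : \forall j \near \oo, 0 < (n j)%:R :> R by exact: near_ow H.
near=> j; apply: (@lt_le_trans _ _ 1) => //.
by near: j; exact: near_nat_ge.
Unshelve. all: by end_near. Qed.

Lemma near_dims : \forall j \near \oo,
  [/\ (0 < k j <= n j)%N & (m j <= n j)%N].
Proof.
have [a0 a1] := andP alpha01; have [b0 b1] := andP beta01.
near=> j.
have n1 : 0 < (n j)%:R :> R.
  apply: (@lt_le_trans _ _ 1) => //; near: j; exact: near_nat_ge.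
have h1 : (m j)%:R / (n j)%:R < 1 :> R.
  by near: j; exact: (cvgr_lt _ m_n).
have h2 : (k j)%:R / (n j)%:R < 1 :> R.
  by near: j; exact: (cvgr_lt _ k_n).
have h3 : 0 < (k j)%:R / (n j)%:R :> R.
  by near: j; exact: (cvgr_gt _ k_n).
move: h1 h2 h3; rewrite !ltr_pdivrMr// !mul1r pmulr_lgt0 ?invr_gt0//.
by rewrite !ltr_nat ltr0n => /ltnW -> /ltnW -> ->.
Unshelve. all: by end_near. Qed.

Lemma card_dims : \forall j \near \oo,
  #|(('I_(m j) + 'I_(n j))%type : finType)|%:R <= 2 * (n j)%:R :> R.
Proof.
apply: filterS near_dims => j [_ mn].
by rewrite card_sum !card_ord -natrM ler_nat mul2n -addnn leq_add2r.
Qed.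

Lemma lawX j i (B : set R) : measurable B ->
  P (sum_family (g j) (h j) i @^-1` B) = normal_prob 0 1 B.
Proof. by move=> mB; have [_] := gh_normal j; apply. Qed.

Lemma centered (X : {RV P >-> R}) (f : R -> R) (c : R) :
  measurable_fun setT f -> (forall x, 0 <= f x) ->
  (\int[P]_w (f (X w))%:E = c%:E)%E ->
  (\int[P]_w (f (X w) - c)%:E = 0)%E.
Proof.
move=> mf f0 fc.
have mfX : measurable_fun setT (fun w => f (X w)).
  exact: (measurableT_comp mf (measurable_funP X)).
have If : P.-integrable setT (fun w => (f (X w))%:E).
  apply/integrableP; split; first exact/measurable_EFinP.
  by under eq_integral do rewrite /= ger0_norm//; rewrite fc ltry.
under eq_integral do rewrite EFinD.
rewrite integralD//; last exact: finite_measure_integrable_cst.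
rewrite fc -[X in (_ + X)%E]/(\int[P]_x (cst (- c)%:E x))%E integral_cst//.
rewrite [X in (_ * X)%E](_ : _ = 1%E); last exact: probability_setT.
by rewrite mule1 -EFinD subrr.
Qed.

Lemma cvg_G : (fun p => G p / N p) @ F --> alpha.
Proof.
(* Independence is assumed for [g] and [h] jointly, so the sum runs over both families, with zero
   summands for [h]. *)
pose f j (i : 'I_(m j) + 'I_(n j)) (x : R) : R :=
  if i is inl _ then x ^+ 2 - 1 else 0.
have H : (fun p => (\sum_i f p.1 i (sum_family (g p.1) (h p.1) i p.2)) / N p) @ F --> (0 : R).
  apply: (@concentration _ _ _ P n n_oo (fun j => ('I_(m j) + 'I_(n j))%type)
    (fun j => sum_family (g j) (h j)) f 2 1) => //.
  - exact: card_dims.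
  - move=> j [i|i]; rewrite /f; last exact: measurable_cst.
    by apply: measurable_funB => //; exact: measurable_funX.
  - move=> j [i|i] x; rewrite /f mul1r; last by rewrite normr0 addr_ge0 ?sqr_ge0.
    by have := sqr_ge0 x => x0; rewrite ler_norml; apply/andP; split; lra.
  - move=> j [i|i] /=; last exact: integral0.
    apply: (@centered (g j i) (fun x => x ^+ 2) 1).
    + exact: measurable_funX.
    + by move=> x; exact: sqr_ge0.
    + have := @expectation_normal_sqr _ _ _ P (g j i) (@lawX j (inl i)) 0.
      by rewrite expr0n addr0; under eq_integral do rewrite addr0.
rewrite -[X in _ --> X]add0r.
have : (fun p => (\sum_i f p.1 i (sum_family (g p.1) (h p.1) i p.2)) / N p
    + (m p.1)%:R / N p) @ F --> 0 + alpha.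
  by apply: cvgD; [exact: H|exact: (cvg_ow P n m_n)].
apply: cvg_trans; apply: near_eq_cvg; apply: nearW => p /=.
rewrite -mulrDl; congr (_ / _); rewrite big_sumType/= [X in _ + X + _]big1// addr0.
rewrite sumrB sumr_const card_ord subrK /G /gamma l2normE.
by apply: eq_bigr => i _; rewrite mxE.
Qed.

Lemma coord_resid_ub free (t x : R) : coord_resid free t x <= 2 * x ^+ 2 + 2 * t ^+ 2.
Proof.
have sq : (x + t) ^+ 2 <= 2 * x ^+ 2 + 2 * t ^+ 2.
  have -> : 2 * x ^+ 2 + 2 * t ^+ 2 = (x + t) ^+ 2 + (x - t) ^+ 2 by ring.
  by rewrite lerDl sqr_ge0.
rewrite /coord_resid; case: free => //; apply: le_trans sq.
by have [h0|h0] := leP (x + t) 0; [|rewrite expr0n sqr_ge0].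
Qed.

Lemma coord_resid_ge0 free (t x : R) : 0 <= coord_resid free t x.
Proof. by rewrite /coord_resid; case: free; exact: sqr_ge0. Qed.

Definition coord_mean (free : bool) (t : R) : R := if free then tail2 t else 1 + t ^+ 2.

Lemma sum_coord_mean (q l : nat) (t : R) : (l <= q)%N ->
  \sum_(i < q) coord_mean (i < q - l)%N t =
  (q%:R - l%:R) * tail2 t + l%:R * (1 + t ^+ 2).
Proof.
move=> lq; rewrite -(big_mkord xpredT (fun i => coord_mean (i < q - l)%N t)).
rewrite (big_cat_nat (n := (q - l)%N))//=; last exact: leq_subr.
have -> : \sum_(0 <= i < q - l) coord_mean (i < q - l)%N t =
    \sum_(0 <= i < q - l) tail2 t by apply: eq_big_nat => i /andP[_ ->].
have -> : \sum_(q - l <= i < q) coord_mean (i < q - l)%N t =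
    \sum_(q - l <= i < q) (1 + t ^+ 2).
  by apply: eq_big_nat => i /andP[h1 _]; rewrite ltnNge h1.
by rewrite !sumr_const_nat subn0 subKn// -natrB// !mulr_natl.
Qed.

Lemma cvg_Q t : (fun p => Q t p / N p) @ F --> psi beta t.
Proof.
pose f j (i : 'I_(m j) + 'I_(n j)) (x : R) : R :=
  if i is inr i then coord_resid (i < n j - k j)%N t x - coord_mean (i < n j - k j)%N t
  else 0.
(* Collects [2 * x ^+ 2 + 2 * t ^+ 2] from [coord_resid_ub] and [|tail2 t| + 1 + t ^+ 2] from the
   mean into [K * (1 + x ^+ 2)]. *)
pose K := 3 + 3 * t ^+ 2 + `|tail2 t|.
have t2 := sqr_ge0 t; have tt := normr_ge0 (tail2 t).
have K0 : 0 < K by rewrite /K; lra.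
have H : (fun p => (\sum_i f p.1 i (sum_family (g p.1) (h p.1) i p.2)) / N p) @ F --> (0 : R).
  apply: (@concentration _ _ _ P n n_oo (fun j => ('I_(m j) + 'I_(n j))%type)
    (fun j => sum_family (g j) (h j)) f 2 K) => //.
  - exact: card_dims.
  - move=> j [i|i]; rewrite /f; first exact: measurable_cst.
    apply: measurable_funB => //; rewrite /coord_resid; case: (i < n j - k j)%N.
      exact: measurable_min_sqr.
    by apply: measurable_funX; exact: measurable_funD.
  - move=> j [i|i] x; have x2 := sqr_ge0 x; rewrite /f.
      by rewrite normr0; apply: mulr_ge0; [exact: ltW|lra].
    apply: (le_trans (ler_normB _ _)); rewrite (ger0_norm (coord_resid_ge0 _ _ _)).
    apply: (@le_trans _ _ (2 * x ^+ 2 + 2 * t ^+ 2 + (`|tail2 t| + (1 + t ^+ 2)))).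
      apply: lerD; first exact: coord_resid_ub.
      by rewrite /coord_mean; case: ifP => _; [lra|rewrite ger0_norm; lra].
    have h1 : 0 <= t ^+ 2 * x ^+ 2 by exact: mulr_ge0.
    have h2 : 0 <= `|tail2 t| * x ^+ 2 by exact: mulr_ge0.
    by rewrite /K; lra.
  - move=> j [i|i] /=; first exact: integral0.
    have lawi := @lawX j (inr i).
    rewrite /coord_mean; case: ifP => _.
      apply: (@centered (h j i) (coord_resid true t)).
      + exact: measurable_min_sqr.
      + by move=> x; exact: coord_resid_ge0.
      + exact: expectation_normal_min.
    apply: (@centered (h j i) (coord_resid false t)).
    + by apply: measurable_funX; exact: measurable_funD.
    + by move=> x; exact: coord_resid_ge0.
    + exact: expectation_normal_sqr.
rewrite -[X in _ --> X]add0r.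
have kF := cvg_ow P n k_n.
have meanF : (fun p => (1 - (k p.1)%:R / N p) * tail2 t
    + (k p.1)%:R / N p * (1 + t ^+ 2)) @ F --> psi beta t.
  have -> : psi beta t = (1 - beta) * tail2 t + beta * (1 + t ^+ 2).
    by rewrite /psi addrC.
  apply: cvgD; apply: cvgM; try exact: cvg_cst; try exact: kF.
  by apply: cvgB; [exact: cvg_cst|exact: kF].
have : (fun p => (\sum_i f p.1 i (sum_family (g p.1) (h p.1) i p.2)) / N p
    + ((1 - (k p.1)%:R / N p) * tail2 t + (k p.1)%:R / N p * (1 + t ^+ 2)))
    @ F --> 0 + psi beta t.
  by apply: cvgD; [exact: H|exact: meanF].
apply: cvg_trans; apply: near_eq_cvg.
near=> p.
have [/andP[_ kn] _] : [/\ (0 < k p.1 <= n p.1)%N & (m p.1 <= n p.1)%N].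
  by near: p; exact: near_ow near_dims.
have Np : 0 < N p by near: p; exact: near_N.
have -> : (1 - (k p.1)%:R / N p) * tail2 t + (k p.1)%:R / N p * (1 + t ^+ 2) =
  ((N p - (k p.1)%:R) * tail2 t + (k p.1)%:R * (1 + t ^+ 2)) / N p.
  by field; rewrite gt_eqF.
rewrite /= -mulrDl; congr (_ / _); rewrite big_sumType/= [X in X + _ + _]big1// add0r.
rewrite sumrB -sum_coord_mean// subrK.
by apply: eq_bigr => i _; rewrite mxE.
Unshelve. all: by end_near. Qed.

Lemma cvg_sqrt_gap t :
  (fun p => Num.sqrt (G p - Q t p) / sN p) @ F --> Num.sqrt (alpha - psi beta t).
Proof.
have : (fun p => Num.sqrt (G p / N p - Q t p / N p)) @ F
    --> Num.sqrt (alpha - psi beta t).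
  apply: continuous_cvg; first exact: sqrt_continuous.
  by apply: cvgB; [exact: cvg_G|exact: cvg_Q].
apply: cvg_trans; apply: near_eq_cvg; apply: nearW => p /=.
by rewrite -mulrBl mulrC sqrtrM ?invr_ge0// sqrtrV// mulrC.
Qed.

Lemma cvg_r : (fun p => r p.1 / sN p) @ F --> rsc.
Proof. exact: (cvg_ow P n r_n). Qed.

Let Marg t p := margin (k p.1) sigma (r p.1) (gv p) (hv p) t.

Definition margin_lim t : R := sigma * Num.sqrt (alpha - psi beta t) - rsc.

Lemma cvg_margin t : (fun p => Marg t p / sN p) @ F --> margin_lim t.
Proof.
have : (fun p => sigma * (Num.sqrt (G p - Q t p) / sN p) - r p.1 / sN p) @ F
   --> margin_lim t.
  apply: cvgB; last exact: cvg_r.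
  by apply: cvgMr; exact: cvg_sqrt_gap.
apply: cvg_trans; apply: near_eq_cvg; apply: nearW => p /=.
by rewrite /Marg /margin mulrBl mulrA.
Qed.

Lemma near_lt (u v : nat * T -> R) (a b : R) : u @ F --> a -> v @ F --> b ->
  a < b -> \forall p \near F, u p < v p.
Proof.
move=> ua vb ab; have vu : (fun p => v p - u p) @ F --> b - a by exact: cvgB.
have : \forall p \near F, 0 < v p - u p.
  by apply: (cvgr_gt _ vu); rewrite subr_gt0.
by apply: filterS => p /=; rewrite subr_gt0.
Qed.

Lemma near_feasible t : psi beta t < alpha -> \forall p \near F, Q t p < G p.
Proof.
move=> pa; near=> p.
have Np : 0 < N p by near: p; exact: near_N.
rewrite -(ltr_pM2r (x := (N p)^-1)) ?invr_gt0//.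
by near: p; apply: near_lt pa; [exact: cvg_Q|exact: cvg_G].
Unshelve. all: by end_near. Qed.

(** * Convergence of the solution at a critical point of the limit program *)

Section InteriorOptimum.
Variables th : R.
Hypotheses (th_gt0 : 0 < th) (below : theta_fun beta th < alpha)
  (critical : alpha - psi beta th = (sigma / rsc * (alpha - theta_fun beta th)) ^+ 2).

Lemma psi_th_lt : psi beta th < alpha.
Proof.
rewrite -subr_gt0 critical exprn_gt0// mulr_gt0 ?divr_gt0//.
by rewrite subr_gt0.
Qed.

(** [strict_optimum] multiplied by [rsc]: the limiting form of the hypotheses [ml] and [mr] of the
    localization. *)
Lemma margin_lim_lt t : t != th -> psi beta t <= alpha ->
  margin_lim t < margin_lim th / th * t.
Proof.
move=> tth pt; have s0 : 0 < sigma / rsc by rewrite divr_gt0.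
have := strict_optimum beta01 s0 th_gt0 below critical tth pt.
rewrite -(ltr_pM2l rsc_gt0).
have -> : rsc * (sigma / rsc * Num.sqrt (alpha - psi beta t)) =
  margin_lim t + rsc by rewrite /margin_lim; field; rewrite gt_eqF.
have -> : rsc * (1 + t / th * (sigma / rsc * Num.sqrt (alpha - psi beta th) - 1)) =
  margin_lim th / th * t + rsc.
  by rewrite /margin_lim; field; rewrite !gt_eqF.
by rewrite ltrD2r.
Qed.

Let sol p := gen_solution (k p.1) sigma (r p.1) (gv p) (hv p).
Let tt p := (sol p).1^-1.

Lemma near_solution e : 0 < e -> e < th ->
  psi beta (th - e) < alpha -> psi beta (th + e) < alpha ->
  \forall p \near F,
  [/\ is_gen_solution (k p.1) sigma (r p.1) (gv p) (hv p) (sol p),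
    0 < tt p, `|tt p - th| <= e,
    radicand (gv p) (hv p) (sol p).1 (sol p).2 =
      (sol p).1 ^+ 2 * (G p - Q (tt p) p) &
    `|Q (tt p) p - Q th p| <= Num.max (Q (th - e) p) (Q (th + e) p) - Q th p].
Proof.
move=> e0 eth pl pr.
have near_margin t : t != th -> psi beta t < alpha ->
    \forall p \near F, Marg t p < Marg th p / th * t.
  move=> tth pt.
  have H : \forall p \near F, Marg t p / sN p < Marg th p / sN p / th * t.
    apply: near_lt (margin_lim_lt tth (ltW pt)); first exact: cvg_margin.
    apply: cvgM; last exact: cvg_cst.
    by apply: cvgM; [exact: cvg_margin|exact: cvg_cst].
  near=> p.
  have Np : 0 < N p by near: p; exact: near_N.
  have sNp : 0 < sN p by rewrite sqrtr_gt0.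
  have : Marg t p / sN p < Marg th p / sN p / th * t by near: p.
  rewrite ltr_pdivrMr//.
  by have -> : Marg th p / sN p / th * t * sN p = Marg th p / th * t
    by field; rewrite !gt_eqF.
near=> p.
have [kn _] : [/\ (0 < k p.1 <= n p.1)%N & (m p.1 <= n p.1)%N].
  by near: p; exact: near_ow near_dims.
have f0 : Q th p < G p by near: p; apply: near_feasible; exact: psi_th_lt.
have fl : Q (th - e) p < G p by near: p; exact: near_feasible.
have fr : Q (th + e) p < G p by near: p; exact: near_feasible.
have ml : Marg (th - e) p < Marg th p / th * (th - e).
  by near: p; apply: near_margin => //; rewrite lt_eqF//; lra.
have mr : Marg (th + e) p < Marg th p / th * (th + e).
  by near: p; apply: near_margin => //; rewrite gt_eqF//; lra.
have ex := gen_solution_exists sigma_gt0 e0 eth (ltW f0) (ltW fl) (ltW fr) ml mr kn.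
have ps := gen_solutionP ex.
have [h1 h2 h3 h4] := gen_solution_near sigma_gt0 e0 eth (ltW f0) ml mr kn ps.
by split.
Unshelve. all: by end_near. Qed.

Lemma small_radius eps : 0 < eps -> exists e,
  [/\ 0 < e, e < th, e <= eps &
   [/\ psi beta (th - e) < alpha, psi beta (th + e) < alpha,
     psi beta (th - e) < psi beta th + eps &
     psi beta (th + e) < psi beta th + eps]].
Proof.
move=> eps0; have pth := psi_th_lt.
pose del := Num.min eps (alpha - psi beta th).
have del0 : 0 < del by rewrite lt_min eps0 subr_gt0.
have [d1 d2] : del <= eps /\ del <= alpha - psi beta th.
  by apply/andP; rewrite -le_min.
have /cvgrPdist_lt /(_ del del0) := @continuous_psi R beta th.
move=> /nbhs_ballP[eta /= eta0 H].
pose e := Num.min (eta / 2) (Num.min eps (th / 2)).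
have e0 : 0 < e by rewrite !lt_min eps0 !divr_gt0.
have : e <= e by []; rewrite {2}/e !le_min => /and3P[e1 e2 e3].
have Hl : `|psi beta th - psi beta (th - e)| < del.
  by apply: H; rewrite /ball/= opprB addrC subrK gtr0_norm//; lra.
have Hr : `|psi beta th - psi beta (th + e)| < del.
  by apply: H; rewrite /ball/= opprD addrA subrr sub0r normrN gtr0_norm//; lra.
move: Hl Hr; rewrite !ltr_norml => /andP[l1 l2] /andP[r1 r2].
exists e; split; [done|lra|done|split; lra].
Qed.

Lemma solution_ow : \forall p \near F,
  exists q, is_gen_solution (k p.1) sigma (r p.1) (gv p) (hv p) q.
Proof.
have [e [e0 eth _ [pl pr _ _]]] := small_radius ltr01.
by apply: filterS (near_solution e0 eth pl pr) => p [ps _ _ _ _]; exists (sol p).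
Qed.

Lemma cvg_tt : tt @ F --> th.
Proof.
apply/cvgrPdist_le => eps eps0.
have [e [e0 eth ee [pl pr _ _]]] := small_radius eps0.
apply: filterS (near_solution e0 eth pl pr) => p [_ _ tth _ _].
by rewrite distrC; exact: le_trans tth ee.
Qed.

(** [cvg_Q] holds for fixed [t] only and [tt] is random. Convexity of [min_resid] bounds the
    variation between [th] and [tt] by the values at [th - e] and [th + e], where [cvg_Q]
    applies. *)
Lemma cvg_Qtt : (fun p => Q (tt p) p / N p) @ F --> psi beta th.
Proof.
have D0 : (fun p => (Q (tt p) p - Q th p) / N p) @ F --> (0 : R).
  apply/cvgrPdist_le => eps eps0.
  have [e [e0 eth _ [pl pr el er]]] := small_radius eps0.
  have gap t : psi beta t < psi beta th + eps ->
      \forall p \near F, Q t p / N p - Q th p / N p < eps.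
    move=> pt; apply: (@near_lt _ (fun=> eps) (psi beta t - psi beta th)).
    - by apply: cvgB; exact: cvg_Q.
    - exact: cvg_cst.
    - lra.
  near=> p.
  have Np : 0 < N p by near: p; exact: near_N.
  have gl : Q (th - e) p / N p - Q th p / N p < eps by near: p; exact: gap.
  have gr : Q (th + e) p / N p - Q th p / N p < eps by near: p; exact: gap.
  have [_ _ _ _ Qtt] : [/\ is_gen_solution (k p.1) sigma (r p.1) (gv p) (hv p) (sol p),
    0 < tt p, `|tt p - th| <= e,
    radicand (gv p) (hv p) (sol p).1 (sol p).2 =
      (sol p).1 ^+ 2 * (G p - Q (tt p) p) &
    `|Q (tt p) p - Q th p| <= Num.max (Q (th - e) p) (Q (th + e) p) - Q th p].
    by near: p; exact: near_solution.
  rewrite sub0r normrN normrM (gtr0_norm (x := (N p)^-1)) ?invr_gt0//.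
  rewrite ler_pdivrMr//; apply: (le_trans Qtt).
  move: gl gr; rewrite -!mulrBl !ltr_pdivrMr// => gl gr.
  by rewrite lerBlDr ge_max; apply/andP; split; lra.
have : (fun p => (Q (tt p) p - Q th p) / N p + Q th p / N p) @ F
    --> 0 + psi beta th.
  by apply: cvgD; [exact: D0|exact: cvg_Q].
rewrite add0r; apply: cvg_trans; apply: near_eq_cvg; apply: nearW => p /=.
by rewrite -mulrDl subrK.
Unshelve. all: by end_near. Qed.

Lemma cvg_nu_gen : (fun p => nu_gen (k p.1) sigma (r p.1) (gv p) (hv p)) @ F
  --> th^-1.
Proof.
have : (fun p => (tt p)^-1) @ F --> th^-1.
  by apply: cvgV; [rewrite gt_eqF|exact: cvg_tt].
by apply: cvg_trans; apply: near_eq_cvg; apply: nearW => p; rewrite /tt invrK.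
Qed.

Lemma cvg_sqrt_scaled (u : nat * T -> R) (a : R) : (fun p => u p / N p) @ F --> a ->
  (fun p => Num.sqrt (u p) / sN p) @ F --> Num.sqrt a.
Proof.
move=> ua; have : (fun p => Num.sqrt (u p / N p)) @ F --> Num.sqrt a.
  by apply: continuous_cvg; [exact: sqrt_continuous|exact: ua].
apply: cvg_trans; apply: near_eq_cvg; apply: nearW => p /=.
by rewrite [_ / N p]mulrC sqrtrM ?invr_ge0// sqrtrV// mulrC.
Qed.

Lemma cvg_gap_tt : (fun p => Num.sqrt (G p - Q (tt p) p) / sN p) @ F
  --> Num.sqrt (alpha - psi beta th).
Proof.
apply: (@cvg_sqrt_scaled (fun p => G p - Q (tt p) p)).
have : (fun p => G p / N p - Q (tt p) p / N p) @ F --> alpha - psi beta th.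
  by apply: cvgB; [exact: cvg_G|exact: cvg_Qtt].
apply: cvg_trans; apply: near_eq_cvg; apply: nearW => p /=.
by rewrite -mulrBl.
Qed.

Lemma near_good : \forall p \near F,
  [/\ is_gen_solution (k p.1) sigma (r p.1) (gv p) (hv p) (sol p),
    0 < tt p & radicand (gv p) (hv p) (sol p).1 (sol p).2 =
      (sol p).1 ^+ 2 * (G p - Q (tt p) p)].
Proof.
have [e [e0 eth _ [pl pr _ _]]] := small_radius ltr01.
by apply: filterS (near_solution e0 eth pl pr) => p [h1 h2 _ h3 _]; split.
Qed.

Lemma cvg_w_gen : (fun p => w_gen (k p.1) sigma (r p.1) (gv p) (hv p)) @ F
  --> sigma * (Num.sqrt (psi beta th) / Num.sqrt (alpha - psi beta th)).
Proof.
have sp : 0 < Num.sqrt (alpha - psi beta th).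
  by rewrite sqrtr_gt0 subr_gt0 psi_th_lt.
have : (fun p => sigma * ((Num.sqrt (Q (tt p) p) / sN p) /
   (Num.sqrt (G p - Q (tt p) p) / sN p))) @ F
  --> sigma * (Num.sqrt (psi beta th) / Num.sqrt (alpha - psi beta th)).
  apply: cvgMr; apply: cvgM.
    exact: (@cvg_sqrt_scaled (fun p => Q (tt p) p) _ cvg_Qtt).
  by apply: cvgV; [rewrite gt_eqF|exact: cvg_gap_tt].
apply: cvg_trans; apply: near_eq_cvg; near=> p.
have [ps tp radE] : [/\ is_gen_solution (k p.1) sigma (r p.1) (gv p) (hv p) (sol p),
    0 < tt p & radicand (gv p) (hv p) (sol p).1 (sol p).2 =
      (sol p).1 ^+ 2 * (G p - Q (tt p) p)] by near: p; exact: near_good.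
have Np : 0 < N p by near: p; exact: near_N.
have sNp : 0 < sN p by rewrite sqrtr_gt0.
have nup : 0 < (sol p).1 by rewrite -invr_gt0.
rewrite /w_gen -/(sol p) radE sqrtrM ?sqr_ge0// sqrtr_sqr gtr0_norm//.
(* Numerator and denominator of [w_gen] both carry the factor [nu], which cancels. *)
have resE : l2norm (residual (hv p) (sol p).1 (sol p).2) =
    (sol p).1 * Num.sqrt (Q (tt p) p).
  have : l2norm (residual (hv p) (sol p).1 (sol p).2) ^+ 2 =
      (sol p).1 ^+ 2 * Q (tt p) p.
    by move: radE; rewrite /radicand /G /gamma; lra.
  move/(congr1 Num.sqrt); rewrite sqrtr_sqr ger0_norm ?sqrtr_ge0//.
  by rewrite sqrtrM ?sqr_ge0// sqrtr_sqr gtr0_norm.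
rewrite resE -!mulrA; congr (_ * _).
rewrite [in LHS]invfM invrK [RHS]mulrCA [in RHS]invfM.
set z := (Num.sqrt (G p - Q (tt p) p))^-1.
by field; rewrite !gt_eqF.
Unshelve. all: by end_near. Qed.

Lemma cvg_xi_gen :
  (fun p => fine (xi_gen (k p.1) sigma (r p.1) (gv p) (hv p)) / sN p) @ F
  --> th^-1 * margin_lim th.
Proof.
have : (fun p => (tt p)^-1 *
   (sigma * (Num.sqrt (G p - Q (tt p) p) / sN p) - r p.1 / sN p)) @ F
   --> th^-1 * margin_lim th.
  apply: cvgM; first by apply: cvgV; [rewrite gt_eqF|exact: cvg_tt].
  apply: cvgB; last exact: cvg_r.
  by apply: cvgMr; exact: cvg_gap_tt.
apply: cvg_trans; apply: near_eq_cvg; near=> p.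
have [ps tp radE] : [/\ is_gen_solution (k p.1) sigma (r p.1) (gv p) (hv p) (sol p),
    0 < tt p & radicand (gv p) (hv p) (sol p).1 (sol p).2 =
      (sol p).1 ^+ 2 * (G p - Q (tt p) p)] by near: p; exact: near_good.
have nup : 0 < (sol p).1 by rewrite -invr_gt0.
rewrite (xi_gen_solution ps)/= /gen_obj radE sqrtrM ?sqr_ge0// sqrtr_sqr.
by rewrite gtr0_norm// /tt invrK; ring.
Unshelve. all: by end_near. Qed.

End InteriorOptimum.

(* When the limiting objective has positive slope at infinity, the programs are
   unbounded with overwhelming probability. *)
Lemma xi_prim_pinfty_ow (xt : forall j, 'cV[R]_(n j)) :
  rsc ^+ 2 < sigma ^+ 2 * (alpha - psi beta 0) ->
  \forall p \near F, xi_prim (k p.1) sigma (r p.1) (gv p) (hv p) (xt p.1) = +oo%E.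
Proof.
move=> slope; have s20 : 0 < sigma ^+ 2 by rewrite exprn_gt0.
have lim_lt t : rsc ^+ 2 < sigma ^+ 2 * (alpha - psi beta t) ->
    rsc < sigma * Num.sqrt (alpha - psi beta t).
  move=> st; have a0 : 0 <= alpha - psi beta t.
    by rewrite -(pmulr_rge0 _ s20) ltW// (le_lt_trans _ st)// sqr_ge0.
  have v0 : 0 <= sigma * Num.sqrt (alpha - psi beta t).
    by rewrite mulr_ge0 ?sqrtr_ge0// ltW.
  have : rsc ^+ 2 < (sigma * Num.sqrt (alpha - psi beta t)) ^+ 2.
    by rewrite exprMn sqr_sqrtr.
  by rewrite ltr_pXn2r ?nnegrE// ltW.
have feas t : rsc ^+ 2 < sigma ^+ 2 * (alpha - psi beta t) -> psi beta t < alpha.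
  move=> st; rewrite -subr_gt0 -(pmulr_rgt0 _ s20) (le_lt_trans _ st)//.
  exact: sqr_ge0.
(* Unboundedness needs a whole segment of values of [1 / nu] adjacent to 0; continuity of [psi]
   provides its other end. *)
have [t0 t00 slope0] : exists2 t0, 0 < t0 &
    rsc ^+ 2 < sigma ^+ 2 * (alpha - psi beta t0).
  pose del := alpha - psi beta 0 - rsc ^+ 2 / sigma ^+ 2.
  have del0 : 0 < del.
    by rewrite subr_gt0 ltr_pdivrMr// mulrC.
  have /cvgrPdist_lt /(_ del del0) := @continuous_psi R beta 0.
  move=> /nbhs_ballP[eta /= eta0 H]; exists (eta / 2); first by rewrite divr_gt0.
  have : `|psi beta 0 - psi beta (eta / 2)| < del.
    by apply: H; rewrite /ball/= sub0r normrN gtr0_norm ?divr_gt0//; lra.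
  rewrite ltr_norml => /andP[h1 h2].
  by rewrite mulrC -ltr_pdivrMr//; move: h1; rewrite /del; lra.
have near_r t : rsc ^+ 2 < sigma ^+ 2 * (alpha - psi beta t) ->
    \forall p \near F, r p.1 < sigma * Num.sqrt (G p - Q t p).
  move=> st.
  have H : \forall p \near F, r p.1 / sN p < sigma * (Num.sqrt (G p - Q t p) / sN p).
    apply: near_lt (lim_lt _ st); first exact: cvg_r.
    by apply: cvgMr; exact: cvg_sqrt_gap.
  near=> p.
  have Np : 0 < N p by near: p; exact: near_N.
  have sNp : 0 < sN p by rewrite sqrtr_gt0.
  rewrite -(ltr_pM2r (x := (sN p)^-1)) ?invr_gt0// -mulrA.
  by near: p.
near=> p.
apply: (@xi_prim_pinfty _ _ _ _ _ _ _ _ sigma_gt0 _ t0) => //.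
- by near: p; exact: near_feasible (feas _ slope).
- by near: p; exact: near_feasible (feas _ slope0).
- have h1 : r p.1 < sigma * Num.sqrt (G p - Q 0 p) by near: p; exact: near_r.
  have h2 : r p.1 < sigma * Num.sqrt (G p - Q t0 p) by near: p; exact: near_r.
  rewrite -/(Q 0 p) -/(Q t0 p) -/(G p).
  by have [_|_] := leP (Q 0 p) (Q t0 p).
Unshelve. all: by end_near. Qed.

(** An integrable function is finite almost everywhere, so the event where [xi_prim] is infinite
    would be null inside the event of integrability. For large [n] both have probability at least
    2/3 and cannot meet in a null set. *)
Lemma slope_le (xt : forall j, 'cV[R]_(n j)) :
  overwhelmingly_finite_mean P n (fun j w =>
    xi_prim (k j) sigma (r j) (random_vector (g j) w) (random_vector (h j) w)
      (xt j)) ->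
  sigma ^+ 2 * (alpha - psi beta 0) <= rsc ^+ 2.
Proof.
move=> [c2 c20 H2]; rewrite leNgt; apply/negP => /(xi_prim_pinfty_ow xt)[c1 c10 H1].
suff : \forall j \near \oo, False by move=> /filter_ex[].
near=> j.
have [E1 [mE1 ES1 PE1]] : exists E : set T, [/\ measurable E,
    E `<=` [set w | xi_prim (k j) sigma (r j) (random_vector (g j) w)
      (random_vector (h j) w) (xt j) = +oo%E] &
    ((1 - expR (- c1 * (n j)%:R))%:E <= P E)%E] by near: j.
have [E2 [mE2 PE2 int2]] : exists E : set T, [/\ measurable E,
    ((1 - expR (- c2 * (n j)%:R))%:E <= P E)%E &
    P.-integrable E (fun w => xi_prim (k j) sigma (r j) (random_vector (g j) w)
      (random_vector (h j) w) (xt j))] by near: j.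
have small c : 0 < c -> 2 / c <= (n j)%:R -> expR (- c * (n j)%:R) <= 3^-1.
  move=> c0; rewrite ler_pdivrMr// => cn.
  rewrite mulNr expRN lef_pV2 ?posrE ?expR_gt0//.
  apply: le_trans (expR_ge1Dx _); rewrite mulrC; lra.
have e1 : expR (- c1 * (n j)%:R) <= 3^-1.
  by apply: small => //; near: j; exact: near_nat_ge.
have e2 : expR (- c2 * (n j)%:R) <= 3^-1.
  by apply: small => //; near: j; exact: near_nat_ge.
have mE12 : measurable (E1 `&` E2) by exact: measurableI.
have P12 : (P (~` (E1 `&` E2)) <= (3^-1 + 3^-1)%:E)%E.
  rewrite setCI; apply: (@le_trans _ _ (P (~` E1) + P (~` E2))%E).
    by apply: measureU2; exact: measurableC.
  rewrite EFinD; apply: leeD; apply: probability_setC_le => //.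
    by apply: le_trans PE1; rewrite lee_fin; lra.
  by apply: le_trans PE2; rewrite lee_fin; lra.
have neg : P.-negligible (E1 `&` E2).
  have := integrable_ae mE2 int2; apply: negligibleS => w [w1 w2] /= /(_ w2).
  by rewrite (ES1 w w1).
have P0 : P (E1 `&` E2) = 0%E by apply: measure_negligible.
have := le_probability_setC mE12 P12; rewrite P0 lee_fin; lra.
Unshelve. all: by end_near. Qed.

End Asymptotics.

Theorem corollary2 (R : realType)
  (d : measure_display) (T : measurableType d) (P : probability T R)
  (alpha beta alpha_w sigma rsc theta : R)
  (n m k : nat -> nat) (r : nat -> R)
  (xt : forall j, 'cV[R]_(n j))
  (A : forall j, 'I_(m j) * 'I_(n j) -> {RV P >-> R})
  (v : forall j, 'I_(m j) -> {RV P >-> R})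
  (g : forall j, 'I_(m j) -> {RV P >-> R})
  (h : forall j, 'I_(n j) -> {RV P >-> R})
  (alpha01 : 0 < alpha < 1) (beta01 : 0 < beta < 1)
  (n_oo : n @ \oo --> \oo)
  (m_n : (m j)%:R / (n j)%:R @[j --> \oo] --> alpha)
  (k_n : (k j)%:R / (n j)%:R @[j --> \oo] --> beta)
  (threshold : signed_l1_threshold beta alpha_w) (below : alpha_w < alpha)
  (sigma_gt0 : 0 < sigma)
  (r_gt0 : forall j, 0 < r j) (rsc_gt0 : 0 < rsc)
  (r_n : r j / Num.sqrt (n j)%:R @[j --> \oo] --> rsc)
  (xt_sparse : forall j, sparse_signed (k j) (xt j))
  (Av_normal : forall j,
     indep_normal (sum_family (fun=> 1) (fun=> sigma)) (sum_family (A j) (v j)))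
  (gh_normal : forall j,
     indep_normal (fun=> 1) (sum_family (g j) (h j)))
  (socp_feas : overwhelming P n (fun j => [set w |
     socp_feasible (r j) (random_matrix (A j) w) (random_vector (v j) w)
       (xt j)]))
  (xi_prim_finite : overwhelmingly_finite_mean P n (fun j w =>
     xi_prim (k j) sigma (r j) (random_vector (g j) w) (random_vector (h j) w)
       (xt j)))
  (theta_hat : is_theta_hat alpha beta sigma rsc theta) :
  let Enu := nu_lim alpha beta sigma rsc theta in
  [/\ overwhelming P n (fun j => [set w | exists p,
        is_gen_solution (k j) sigma (r j)
          (random_vector (g j) w) (random_vector (h j) w) p]),
      concentrating_point P n (fun j w =>
        nu_gen (k j) sigma (r j)
          (random_vector (g j) w) (random_vector (h j) w))
        Enu,
      concentrating_point P n (fun j w =>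
        w_gen (k j) sigma (r j)
          (random_vector (g j) w) (random_vector (h j) w))
        (w_lim alpha beta sigma theta Enu) &
      concentrating_point P n (fun j w =>
        fine (xi_gen (k j) sigma (r j)
          (random_vector (g j) w) (random_vector (h j) w))
        / Num.sqrt (n j)%:R)
        (xi_lim alpha beta sigma rsc theta Enu)].
Proof.
move=> Enu.
have [tnu thE cases] :=
  theta_hat_cases beta01 sigma_gt0 rsc_gt0 threshold below theta_hat.
(* The spurious root would make the program unbounded, against the finiteness of the mean of
   [xi_prim]. *)
case: cases => [[_ slope]|[t0 th_lt crit]].
  have := slope_le alpha01 beta01 n_oo m_n k_n sigma_gt0 rsc_gt0 r_n gh_normal xi_prim_finite.
  by rewrite leNgt slope.
set t := Fp beta theta in tnu thE t0 crit.
have EnuE : Enu = t^-1.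
  by apply: (@mulfI _ t); rewrite ?gt_eqF// divff ?gt_eqF.
have {}th_lt : theta_fun beta t < alpha by rewrite thE.
have {}crit : alpha - psi beta t =
    (sigma / rsc * (alpha - theta_fun beta t)) ^+ 2 by rewrite thE.
have psi_lt := psi_th_lt sigma_gt0 rsc_gt0 th_lt crit.
have resE : res_lim beta theta Enu = Enu ^+ 2 * psi beta t by exact: res_limE.
have nu0 : 0 < Enu by rewrite EnuE invr_gt0.
split.
- exact: (solution_ow alpha01 beta01 n_oo m_n k_n sigma_gt0 rsc_gt0 r_n gh_normal t0 th_lt crit).
- apply: concentrating_point_cvg => //; rewrite EnuE.
  exact: (cvg_nu_gen alpha01 beta01 n_oo m_n k_n sigma_gt0 rsc_gt0 r_n gh_normal t0 th_lt crit).
- apply: concentrating_point_cvg => //.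
  have -> : w_lim alpha beta sigma theta Enu =
      sigma * (Num.sqrt (psi beta t) / Num.sqrt (alpha - psi beta t)).
    rewrite /w_lim resE; congr (_ * _).
    have -> : Enu ^+ 2 * psi beta t / (alpha * Enu ^+ 2 - Enu ^+ 2 * psi beta t) =
        (alpha - psi beta t)^-1 * psi beta t.
      rewrite [alpha * _]mulrC -mulrBr -mulf_div divff ?mul1r 1?mulrC//.
      by rewrite expf_neq0// gt_eqF.
    have a0 : 0 <= alpha - psi beta t by rewrite subr_ge0 ltW.
    by rewrite sqrtrM ?invr_ge0// sqrtrV// mulrC.
  exact: (cvg_w_gen alpha01 beta01 n_oo m_n k_n sigma_gt0 rsc_gt0 r_n gh_normal t0 th_lt crit).
- apply: concentrating_point_cvg => //.
  have -> : xi_lim alpha beta sigma rsc theta Enu =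
      t^-1 * margin_lim alpha beta sigma rsc t.
    rewrite /xi_lim /margin_lim resE [alpha * _]mulrC -mulrBr sqrtrM ?sqr_ge0//.
    by rewrite sqrtr_sqr gtr0_norm// EnuE; ring.
  exact: (cvg_xi_gen alpha01 beta01 n_oo m_n k_n sigma_gt0 rsc_gt0 r_n gh_normal t0 th_lt crit).
Qed.
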